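(* Let $\{Y(t)\}_{t\ge 0}$ be a Lévy process with Laplace exponent $\psi(\cdot)$. Let $\alpha\in(0,1)$, and let $\{S_\alpha(t)\}_{t\ge0}$ be the incomplete gamma (InG) subordinator, independent of $\{Y(t)\}_{t\ge0}$. Put $Q_\alpha(t):=Y(S_\alpha(t))$, $t\ge 0$. Assume that there exist constants $c\in\mathbb{R}$ and $\beta\in(0,1)$ such that $$\frac{\psi(\eta)^{\alpha}}{\eta}\sim c^{\alpha}\eta^{\beta-1}\qquad\text{as } \eta\to 0.$$ Then for any $t\ge 0$, $$\mathbb{P}(Q_\alpha(t)>x)\sim \frac{c^{\alpha}\,t\,x^{-\beta}}{\Gamma(1-\beta)}\qquad\text{as } x\to\infty.$$
   Context: The Laplace exponent $\psi$ of a Lévy process $\{Y(t)\}_{t\ge0}$ is defined by $\mathbb{E}[e^{-\eta Y(t)}]=e^{-t\psi(\eta)}$, $\eta>0$. The lower incomplete gamma function is $\gamma(\alpha;\eta)=\int_0^\eta e^{-y}y^{\alpha-1}\,dy$. The incomplete gamma (InG) subordinator $\{S_\alpha(t)\}_{t\ge0}$, $0<\alpha\le1$, is the non-decreasing Lévy process with $\mathbb{E}[e^{-\eta S_\alpha(t)}]=e^{-t\alpha\gamma(\alpha;\eta)}$, $\eta>0$. The notation $g\sim h$ means that the ratio $g/h$ tends to $1$ in the indicated limit. *)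

(* Defs.v *)
From HB Require Import structures.
From mathcomp Require Import all_boot all_order all_algebra.
From mathcomp Require Import all_classical all_reals all_analysis.

Set Implicit Arguments.
Unset Strict Implicit.
Unset Printing Implicit Defensive.

Import Order.TTheory GRing.Theory Num.Theory.
Import numFieldNormedType.Exports.

Local Open Scope classical_set_scope.
Local Open Scope ring_scope.

(** [g ~ h] along [F]: the ratio [g / h] tends to [1].  Since [u / 0 = 0], the
    first disjunct forces [h] to be eventually nonzero.  The second disjunct is
    the usual convention [0 ~ 0]; it is needed because both sides of the tail
    asymptotics vanish at time [0]. *)
Definition asymp_equiv (R : realType) (F : set_system R) (g h : R -> R) : Prop :=
  ((fun x => g x / h x) @ F --> (1 : R)) \/
  (\forall x \near F, g x = 0 /\ h x = 0).

Definition lower_incomplete_gamma (R : realType) (alpha eta : R) : R :=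
  (\int[lebesgue_measure]_(y in `]0%R, eta]) (expR (- y) * y `^ (alpha - 1)))%R.

Definition Gamma (R : realType) (a : R) : R :=
  (\int[lebesgue_measure]_(y in `]0%R, +oo[) (expR (- y) * y `^ (a - 1)))%R.

(** Taking some of the [B i] to be [setT] gives the product rule for every
    subfamily, so this is mutual independence. *)
Definition mutually_independent d (T : measurableType d) (R : realType)
    (P : probability T R) (n : nat) (X : 'I_n -> T -> R) : Prop :=
  forall B : 'I_n -> set R, (forall i, measurable (B i)) ->
    (P (\bigcap_(i in [set: 'I_n]) (X i @^-1` B i)) =
     \prod_(i < n) P (X i @^-1` B i))%E.

(** Stochastic processes are families indexed by [R]; only the times [t >= 0]
    are meaningful. *)
Section levy.
Context d (T : measurableType d) (R : realType) (P : probability T R).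
Implicit Types X Y S : R -> {RV P >-> R}.

Record levy_process X : Prop := LevyProcess {
  levy_start : {ae P, forall w, X 0 w = 0} ;
  levy_indep_increments : forall (n : nat) (t : nat -> R),
    0 <= t 0%N -> {homo t : i j / (i <= j)%N >-> i <= j} ->
    mutually_independent P (fun (i : 'I_n) w => X (t i.+1) w - X (t i) w) ;
  levy_stationary_increments : forall s t : R, 0 <= s -> 0 <= t ->
    forall B : set R, measurable B ->
      P [set w | B (X (s + t) w - X s w)] = P [set w | B (X t w)] ;
  levy_stochastic_continuity : forall (s e : R), 0 <= s -> 0 < e ->
    P [set w | e < `|X t w - X s w|] @[t --> within [set u | 0 <= u] (nbhs s)]
      --> 0%E ;
  levy_cadlag : {ae P, forall w, forall t : R, 0 <= t ->
    (X u w @[u --> t^'+] --> X t w) /\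
    (0 < t -> cvg (X u w @[u --> t^'-]))} }.

Definition laplace_exponent X (psi : R -> R) : Prop :=
  forall t eta : R, 0 <= t -> 0 < eta ->
    ('E_P[fun w => expR (- (eta * X t w))] = (expR (- (t * psi eta)))%:E)%E.

Record InG_subordinator (alpha : R) S : Prop := InGSubordinator {
  InG_levy : levy_process S ;
  InG_nondecreasing : {ae P, forall w, forall s t : R,
    0 <= s -> s <= t -> S s w <= S t w} ;
  InG_laplace :
    laplace_exponent S (fun eta => alpha * lower_incomplete_gamma alpha eta) }.

Definition process_sigma_algebra X : set (set T) :=
  <<s [set A | exists t : R, 0 <= t /\
               exists B : set R, measurable B /\ A = X t @^-1` B] >>.

Definition independent_processes X Y : Prop :=
  forall A B : set T, process_sigma_algebra X A -> process_sigma_algebra Y B ->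
    (P (A `&` B) = P A * P B)%E.

(** Paths of a Levy process are only almost surely cadlag, so [Y (S t w) w] is
    determined, and known to be measurable, only up to a null set: [Q] is any
    version of [t |-> Y (S t)]. *)
Definition subordinated Y S (Q : R -> {RV P >-> R}) : Prop :=
  forall t : R, 0 <= t -> {ae P, forall w, Q t w = Y (S t w) w}.

End levy.

(* Main.v *)
Require Import Defs.
From HB Require Import structures.
From mathcomp Require Import all_boot all_order all_algebra.
From mathcomp Require Import all_classical all_reals all_analysis.
From mathcomp Require Import measurable_realfun ring lra.
Import Order.TTheory GRing.Theory Num.Theory.
Import numFieldNormedType.Exports.
Local Open Scope classical_set_scope.
Local Open Scope ring_scope.

(** Conditioning on the subordinator gives, for small [eta],
    [E exp (- eta Q_t) = E exp (- psi(eta) S_t) = exp (- t alpha gamma(alpha; psi(eta)))];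
    since [Y] has merely a.s. right-continuous paths, this is obtained by
    discretising [S_t] from the right and passing to the limit with a bound in
    L2.  As [alpha gamma(alpha; u) ~ u^alpha] at 0, this yields
    [1 - E exp (- eta Q_t) ~ t c^alpha eta^beta].  The negative part of [Q_t]
    has an exponential moment, so it contributes only [O(eta) = o(eta^beta)].
    Karamata's argument then recovers the tail: the measures
    [eta^(-beta) (1 - v) law(v)], where [v = exp (- eta max(Q_t, 0))], have the
    moments, in the limit, of the image under [x |-> exp (- x)] of
    [L / Gamma(1 - beta) (1 - exp (- x)) beta x^(- beta - 1) dx] with
    [L = t c^alpha], so by Weierstrass they converge on Lipschitz functions,
    and such functions sandwich [1_{v < 1/e} / (1 - v)]. *)

Set Implicit Arguments.
Unset Strict Implicit.
Unset Printing Implicit Defensive.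

(** * Weierstrass approximation and positive functionals *)

(** [Y] may take both signs, so [exp (- eta Y)] has no pathwise bound. Its square is the same
    exponential at [2 eta], so the L2 bound comes from [psi (2 eta) >= 0], a sign that the
    assumption on [psi] grants only near 0. The unweighted law of [v] collapses to the point mass at
    1 as [eta] tends to 0 and hides the tail. The factor [1 - v] removes that mass, and
    [eta^(-beta)] restores a total mass tending to [L]. Since [v^k] at [eta] is [v] at [k eta], the
    k-th moment is a difference of two rescaled copies of the known limit and tends to
    [L ((k+1)^beta - k^beta)]. Undoing the weight by [1 / (1 - v)] is harmless on [v < 1/e], away
    from 1. A limit constant 0 would give only a tail that is [o (x^(-beta))], whereas [asymp_equiv]
    then asks for a tail that is exactly 0 near infinity. The degenerate cases are therefore settled
    by showing that [Q_t] vanishes almost surely. *)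

(** The value at [x] is the mean of [f N] for [N] binomial with parameters [n] and [x]; the
    recursion conditions on one trial, a success shifting [f]. Moments then follow by induction,
    without binomial coefficients. *)
Fixpoint bernstein (R : comNzRingType) (n : nat) (f : nat -> R) : {poly R} :=
  if n is m.+1 then 'X * bernstein m (f \o succn) + (1 - 'X) * bernstein m f
  else (f 0%N)%:P.

Section bernstein.
Context (R : realFieldType).
Implicit Types (f g : nat -> R) (x : R).

Lemma bernsteinS n f x : (bernstein n.+1 f).[x] =
  x * (bernstein n (f \o succn)).[x] + (1 - x) * (bernstein n f).[x].
Proof. by rewrite /= !(hornerD, hornerM, hornerX, hornerN, hornerC). Qed.

Lemma bernsteinD n f g a x : (bernstein n (fun k => a * f k + g k)).[x] =
  a * (bernstein n f).[x] + (bernstein n g).[x].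
Proof.
elim: n f g => [|n IH] f g; first by rewrite /= !hornerC.
by rewrite !bernsteinS !IH; ring.
Qed.

Lemma bernstein_cst n a x : (bernstein n (fun=> a)).[x] = a.
Proof.
elim: n => [|n IH]; first by rewrite /= hornerC.
by rewrite bernsteinS !IH; ring.
Qed.

(** Squared bias plus variance of the binomial law. The centre [c] is arbitrary because the
    induction moves it to [c - 1]. *)
Lemma bernstein_variance n c x :
  (bernstein n (fun k => (k%:R - c) ^+ 2)).[x] =
  (n%:R * x - c) ^+ 2 + n%:R * x * (1 - x).
Proof.
elim: n c => [|n IH] c; first by rewrite /= hornerC; ring.
rewrite bernsteinS IH -natr1.
rewrite (_ : _ \o _ = fun k => (k%:R - (c - 1)) ^+ 2); last first.
  by apply/funext => k /=; rewrite -natr1; ring.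
by rewrite IH; ring.
Qed.

Lemma le_bernstein n f g x : 0 <= x <= 1 ->
  (forall k, (k <= n)%N -> f k <= g k) ->
  (bernstein n f).[x] <= (bernstein n g).[x].
Proof.
move=> /andP[x0 x1]; elim: n f g => [|n IH] f g fg.
  by rewrite /= !hornerC fg.
rewrite !bernsteinS lerD// ler_wpM2l ?subr_ge0// IH// => k kn.
  by apply: fg.
by apply: fg; rewrite leqW.
Qed.

End bernstein.

(** Chebyshev's argument without splitting the range: the oscillation of [g] lies below a quadratic
    plus [e / 2], and the mean of that majorant is an explicit variance. *)
Lemma weierstrass_lipschitz (R : realType) (g : R -> R) (L : R) :
  (forall x y : R, 0 <= x <= 1 -> 0 <= y <= 1 -> `|g x - g y| <= L * `|x - y|) ->
  forall e : R, 0 < e ->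
  exists p : {poly R}, forall x : R, 0 <= x <= 1 -> `|p.[x] - g x| <= e.
Proof.
move=> gL e e0.
have L0 : 0 <= L.
  have h0 : 0 <= (0 : R) <= 1 by rewrite lexx ler01.
  have h1 : 0 <= (1 : R) <= 1 by rewrite lexx ler01.
  have := gL _ _ h0 h1.
  by rewrite sub0r normrN1 mulr1; apply: le_trans.
pose K := L ^+ 2 / (2 * e).
have K0 : 0 <= K by rewrite divr_ge0 ?sqr_ge0 ?mulr_ge0 // ltW.
(* AM-GM *)
have gK (x y : R) : 0 <= x <= 1 -> 0 <= y <= 1 ->
    `|g x - g y| <= K * (x - y) ^+ 2 + e / 2.
  move=> x01 y01; apply: le_trans (gL _ _ x01 y01) _.
  rewrite -(real_normK (num_real (x - y))) /K.
  set d := `|x - y|.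
  have -> : L ^+ 2 / (2 * e) * d ^+ 2 + e / 2 =
    L * d + (L * d - e) ^+ 2 / (2 * e) by field; rewrite gt_eqF.
  by rewrite lerDl divr_ge0 ?sqr_ge0 ?mulr_ge0 // ltW.
(* The variance term contributes at most [K / n], which this [n] brings below [e / 2]. *)
pose n := (Num.truncn (2 * K / e)).+1.
have nK : K / n%:R <= e / 2.
  have : 2 * K / e < n%:R by rewrite truncnS_gt.
  rewrite ltr_pdivrMr// => h.
  by rewrite ler_pdivrMr ?ltr0n//; lra.
exists (bernstein n (fun k => g (k%:R / n%:R))) => x x01.
pose h k := K / n%:R ^+ 2 * (k%:R - n%:R * x) ^+ 2 + e / 2.
have n0 : n%:R != 0 :> R by rewrite pnatr_eq0.
have gh k : (k <= n)%N -> `|g (k%:R / n%:R) - g x| <= h k.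
  move=> kn; apply: le_trans (gK _ _ _ x01) _.
    by rewrite divr_ge0//= ler_pdivrMr ?ltr0n// mul1r ler_nat.
  by rewrite /h le_eqVlt; apply/orP; left; apply/eqP; field.
have he : (bernstein n h).[x] <= e.
  rewrite /h bernsteinD bernstein_variance bernstein_cst subrr expr0n/= add0r.
  have -> : K / n%:R ^+ 2 * (n%:R * x * (1 - x)) = K / n%:R * (x * (1 - x)).
    by field.
  have : K / n%:R * (x * (1 - x)) <= K / n%:R * 1.
    apply: ler_wpM2l; first by rewrite divr_ge0.
    by move: x01 => /andP[? ?]; nra.
  lra.
apply: le_trans he.
have -> : (bernstein n (fun k => g (k%:R / n%:R))).[x] - g x =
    (bernstein n (fun k => 1 * g (k%:R / n%:R) + (- g x))).[x].
  by rewrite bernsteinD bernstein_cst mul1r.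
rewrite ler_norml; apply/andP; split.
  rewrite lerNl -mulN1r -[X in X <= _]addr0 -[X in _ + X](bernstein_cst n 0 x).
  rewrite -bernsteinD; apply: le_bernstein => // k kn.
  by have := gh _ kn; rewrite ler_norml => /andP[]; lra.
apply: le_bernstein => // k kn.
by have := gh _ kn; rewrite ler_norml => /andP[]; lra.
Qed.

Section positive_functional.
Context (R : realType).
Implicit Types (L : (R -> R) -> R).

(** Stands for a finite positive measure on the unit interval. The axioms speak of continuous
    functions only, since an integral is additive only on integrable ones. *)
Record positive_functional L : Prop := PositiveFunctional {
  functionalD : forall (a : R) (f g : R -> R), continuous f -> continuous g ->
    L (fun x => a * f x + g x) = a * L f + L g ;
  functional_le : forall (f g : R -> R), continuous f -> continuous g ->
    (forall x : R, 0 <= x <= 1 -> f x <= g x) -> L f <= L g }.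

Lemma continuous_horner (p : {poly R}) : continuous (fun x => p.[x]).
Proof.
elim/poly_ind: p => [|p c IH] x.
  rewrite (_ : (fun _ => _) = fun=> 0); first exact: cvg_cst.
  by apply/funext => y; rewrite horner0.
rewrite (_ : (fun _ => _) = fun y => p.[y] * y + c).
  by apply: cvgD; [apply: cvgM; [exact: IH|exact: cvg_id]|exact: cvg_cst].
by apply/funext => y; rewrite hornerD hornerM hornerX hornerC.
Qed.

Lemma functional_cst L c : positive_functional L -> L (fun=> c) = c * L (fun=> 1).
Proof.
move=> PL; have c1 : continuous (fun _ : R => 1 : R) by move=> ?; exact: cvg_cst.
have h := functionalD PL 0 c1 c1.
(* The combination is the zero function, so this instance gives [L 0 = 0]. *)
have h0 := functionalD PL (-1) c1 c1.
have cs : continuous (fun _ : R => 0 : R) by move=> ?; exact: cvg_cst.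
have h1 := functionalD PL c c1 cs.
have e0 : (fun _ : R => -1 * 1 + 1 : R) = fun=> 0 by apply/funext => x; ring.
have e1 : (fun _ : R => c * 1 + 0 : R) = fun=> c by apply/funext => x; ring.
by rewrite e0 in h0; rewrite e1 h0 in h1; rewrite h1; ring.
Qed.

Lemma functional_horner L p : positive_functional L ->
  L (fun x => p.[x]) = \sum_(k < size p) p`_k * L (fun x => x ^+ k).
Proof.
move=> PL.
have cX k : continuous (fun x : R => x ^+ k) by exact: exprn_continuous.
suff h n : L (fun x => \sum_(k < n) p`_k * x ^+ k) =
    \sum_(k < n) p`_k * L (fun x => x ^+ k).
  rewrite -h; congr L; apply/funext => x; exact: horner_coef.
elim: n => [|n IH].
  rewrite big_ord0.
  under eq_fun do rewrite big_ord0.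
  by rewrite functional_cst// mul0r.
rewrite big_ord_recr/= -IH.
rewrite [RHS]addrC -functionalD//; last first.
  rewrite (_ : (fun _ => _) = fun x => (\poly_(k < n) p`_k).[x]).
    exact: continuous_horner.
  by apply/funext => x; rewrite horner_poly.
by congr L; apply/funext => x; rewrite big_ord_recr addrC.
Qed.

(* By Weierstrass, [g] is uniformly close to a polynomial; positivity turns
   this into closeness of the functionals, uniformly in the index. *)
Lemma cvg_functional_lipschitz (I : Type) (F : set_system I) {FF : Filter F}
    (L : I -> (R -> R) -> R) (L0 : (R -> R) -> R) :
  (\forall i \near F, positive_functional (L i)) -> positive_functional L0 ->
  (forall k : nat, L i (fun x => x ^+ k) @[i --> F] --> L0 (fun x => x ^+ k)) ->
  forall (g : R -> R) (K : R), continuous g ->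
  (forall x y : R, 0 <= x <= 1 -> 0 <= y <= 1 -> `|g x - g y| <= K * `|x - y|) ->
  L i g @[i --> F] --> L0 g.
Proof.
move=> PL P0 LX g K cg gK.
have Lp (p : {poly R}) : L i (fun x => p.[x]) @[i --> F] --> L0 (fun x => p.[x]).
  rewrite functional_horner//.
  apply: cvg_trans (_ : (\sum_(k < size p) p`_k * L i (fun x => x ^+ k)) @[i --> F] --> _).
    apply: near_eq_cvg; near=> i; rewrite functional_horner//; near: i; exact: PL.
  elim: (size p) => [|n IH].
    rewrite big_ord0; under eq_fun do rewrite big_ord0.
    exact: cvg_cst.
  rewrite big_ord_recr/=; under eq_fun do rewrite big_ord_recr/=.
  by apply: cvgD => //; apply: cvgM; [exact: cvg_cst|exact: LX].
have c1 : continuous (fun _ : R => 1 : R) by move=> ?; exact: cvg_cst.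
have L1 : L i (fun=> 1) @[i --> F] --> L0 (fun=> 1).
  by have := LX 0%N; under eq_fun do under eq_fun do rewrite expr0.
have sand L' (p : {poly R}) (e : R) : positive_functional L' ->
    (forall x : R, 0 <= x <= 1 -> `|p.[x] - g x| <= e) ->
    `|L' (fun x => p.[x]) - L' g| <= e * L' (fun=> 1).
  move=> PL' pe.
  have cp := @continuous_horner p.
  have ce a : continuous (fun x => a * 1 + g x).
    by move=> x; apply: cvgD; [exact: cvg_cst|exact: cg].
  rewrite ler_distl -!mulNr; apply/andP; split.
    rewrite addrC -functionalD//; apply: functional_le => // x x01.
    by have := pe _ x01; rewrite ler_norml => /andP[]; lra.
  rewrite addrC -functionalD//; apply: functional_le => // x x01.
  by have := pe _ x01; rewrite ler_norml => /andP[]; lra.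
apply/cvgrPdist_le => e e0.
(* [M] bounds the mass of [L0] and, eventually, that of [L i]; with precision [e / (3 * M)] each of
   the three error terms is at most [e / 3]. *)
pose M := `|L0 (fun=> 1)| + 1.
have M0 : 0 < M by rewrite ltr_wpDl.
have eM : 0 < e / (3 * M) by rewrite divr_gt0 ?mulr_gt0.
have [p pe] := weierstrass_lipschitz gK eM.
near=> i.
have PLi : positive_functional (L i) by near: i.
have h1 := sand _ _ _ PLi pe.
have h0 := sand _ _ _ P0 pe.
have Lpi : `|L0 (fun x => p.[x]) - L i (fun x => p.[x])| <= e / 3.
  by near: i; move/cvgrPdist_le : (Lp p); apply; rewrite divr_gt0.
have LM : L i (fun=> 1) <= M.
  have : `|L0 (fun=> 1) - L i (fun=> 1)| <= 1.
    by near: i; move/cvgrPdist_le : L1; apply.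
  have := ler_norm (L0 (fun=> 1)).
  by rewrite ler_norml /M => ? /andP[]; lra.
have L0M : L0 (fun=> 1) <= M by rewrite /M (le_trans (ler_norm _))// lerDl.
have e3 : e / (3 * M) * M = e / 3 by field; rewrite gt_eqF.
have h1' := le_trans h1 (ler_wpM2l (ltW eM) LM).
have h0' := le_trans h0 (ler_wpM2l (ltW eM) L0M).
rewrite e3 in h1' h0'.
have -> : L0 g - L i g = (L0 g - L0 (fun x => p.[x])) +
  (L0 (fun x => p.[x]) - L i (fun x => p.[x])) + (L i (fun x => p.[x]) - L i g).
  ring.
apply: le_trans (ler_normD _ _) _.
apply: le_trans (lerD (ler_normD _ _) (lexx _)) _.
rewrite (distrC (L0 g)); lra.
Unshelve. all: by end_near. Qed.

End positive_functional.

(** Integration against the image under [X] of the measure with density [W]. A continuous [f] is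
    bounded on the unit interval, so a multiple of [W] dominates the integrand. This serves both the
    weighted laws of [v] and their limit. *)
Lemma weighted_integral_positive d (T : measurableType d) (R : realType)
    (mu : {measure set T -> \bar R}) (D : set T) (X W : T -> R) :
  measurable D -> measurable_fun D X -> (forall w, D w -> 0 <= X w <= 1) ->
  mu.-integrable D (EFin \o W) -> (forall w, D w -> 0 <= W w) ->
  positive_functional (fun f => \int[mu]_(w in D) (f (X w) * W w))%R.
Proof.
move=> mD mX X01 iW W0.
have intf (f : R -> R) : continuous f -> mu.-integrable D (fun w => (f (X w) * W w)%:E).
  move=> cf.
  have cfw : {within `[0, 1], continuous f} by exact: continuous_subspaceT.
  have [cM _ HM] := EVT_max ler01 cfw.
  have [cm _ Hm] := EVT_min ler01 cfw.
  pose M := `|f cM| + `|f cm|.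
  have fM (x : R) : 0 <= x <= 1 -> `|f x| <= M.
    move=> x01; have xI : x \in `[0, 1] by rewrite in_itv.
    have := HM _ xI; have := Hm _ xI.
    have := ler_norm (f cM); have := ler_norm (- f cm); rewrite normrN.
    have := normr_ge0 (f cM); have := normr_ge0 (f cm).
    rewrite ler_norml /M => *; apply/andP; split; lra.
  apply: (@le_integrable _ _ _ mu D mD _ (fun w => (M * W w)%:E)).
  - apply/measurable_EFinP; apply: measurable_funM.
      apply: (@measurable_comp _ _ _ _ _ _ setT) => //.
      exact: continuous_measurable_fun.
    by move/integrableP : iW => [/measurable_EFinP].
  - move=> w Dw /=; rewrite lee_fin !normrM.
    rewrite ler_wpM2r// (le_trans (fM _ (X01 _ Dw)))// ler_norm //.
  - rewrite (_ : (fun _ => _) = (fun w => M%:E * (EFin \o W) w)%E) //.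
    exact: integrableZl.
split => [a f g cf cg|f g cf cg fg].
  rewrite -(RintegralZl a mD (intf _ cf)) -RintegralD//; last first.
  - exact: intf.
  - rewrite (_ : _ \o _ = (fun w => a%:E * (f (X w) * W w)%:E)%E) //.
    by apply: integrableZl => //; exact: intf.
  by apply: eq_Rintegral => w _; rewrite mulrDl mulrA.
apply: le_Rintegral => //; [exact: intf|exact: intf|].
by move=> w Dw; rewrite ler_wpM2r// ?W0// fg// X01.
Qed.

(** * Power-law and gamma integrals *)

Section improper_integrals.
Context (R : realType).
Notation mu := (@lebesgue_measure R).
Implicit Types (f g F : R -> R) (a b : R^nat).

Lemma continuous_gt0_measurable f (D : set R) : measurable D ->
  D `<=` `]0, +oo[ -> (forall x : R, 0 < x -> {for x, continuous f}) ->
  measurable_fun D f.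
Proof.
move=> mD D0 cf; apply: (measurable_funS _ D0) => //.
apply: open_continuous_measurable_fun => // x.
by rewrite inE/= in_itv/= andbT => /cf.
Qed.

Lemma cvg_integral_exhaustion f a b : (forall x : R, 0 < x -> 0 <= f x) ->
  (forall x : R, 0 < x -> {for x, continuous f}) ->
  (forall n, 0 < a n) -> nonincreasing_seq a -> nondecreasing_seq b ->
  (\int[mu]_(x in `[a n, b n]) (f x)%:E @[n --> \oo] -->
   \int[mu]_(x in \bigcup_n `[a n, b n]%classic) (f x)%:E)%E.
Proof.
move=> f0 cf a0 da db.
have sub0 n : `[a n, b n]%classic `<=` `]0, +oo[%classic.
  by move=> x /=; rewrite !in_itv/= andbT => /andP[+ _]; exact: lt_le_trans.
apply: ge0_nondecreasing_set_cvg_integral.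
- move=> m n mn; rewrite subsetEset => x /=; rewrite !in_itv/= => /andP[ax xb].
  by rewrite (le_trans (da _ _ mn))//= (le_trans xb)// db.
- by move=> n; exact: measurable_itv.
- by move=> n; apply/measurable_EFinP; apply: continuous_gt0_measurable.
- move=> n x /sub0 /=; rewrite in_itv/= andbT lee_fin; exact: f0.
Qed.

(** Improper integration by parts for nonnegative integrands: on each compact piece the fundamental
    theorem applies to [F], and both integrals increase with the piece. In the extended reals the
    identity holds whether or not they are finite; [f2 = 0] gives the plain improper integral. *)
Lemma FTC_exhaustion f1 f2 F a b (l : R) :
  (forall x : R, 0 < x -> 0 <= f1 x) -> (forall x : R, 0 < x -> 0 <= f2 x) ->
  (forall x : R, 0 < x -> {for x, continuous f1}) ->
  (forall x : R, 0 < x -> {for x, continuous f2}) ->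
  (forall x : R, 0 < x -> is_derive x 1 F (f1 x - f2 x)) ->
  (forall n, 0 < a n < b n) -> nonincreasing_seq a -> nondecreasing_seq b ->
  F (b n) - F (a n) @[n --> \oo] --> l ->
  (\int[mu]_(x in \bigcup_n `[a n, b n]%classic) (f1 x)%:E =
   \int[mu]_(x in \bigcup_n `[a n, b n]%classic) (f2 x)%:E + l%:E)%E.
Proof.
move=> f10 f20 cf1 cf2 dF ab da db Fl.
have a0 n : 0 < a n by have /andP[] := ab n.
have h1 := cvg_integral_exhaustion f10 cf1 a0 da db.
have h2 := cvg_integral_exhaustion f20 cf2 a0 da db.
apply: (cvg_unique _ h1) => //.
have E n : (\int[mu]_(x in `[a n, b n]) (f1 x)%:E =
   \int[mu]_(x in `[a n, b n]) (f2 x)%:E + (F (b n) - F (a n))%:E)%E.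
  have /andP[an abn] := ab n.
  have pos (x : R) : x \in `[a n, b n] -> 0 < x.
    by rewrite in_itv/= => /andP[+ _]; exact: lt_le_trans.
  have poso (x : R) : x \in `]a n, b n[ -> 0 < x.
    by rewrite in_itv/= => /andP[+ _]; exact: lt_trans.
  have cw (f : R -> R) : (forall x : R, 0 < x -> {for x, continuous f}) ->
      {within `[a n, b n], continuous f}.
    move=> cf; apply: continuous_in_subspaceT => x; rewrite inE/= => xab.
    exact/cf/pos.
  have cF (x : R) : 0 < x -> {for x, continuous F}.
    move=> x0; apply: differentiable_continuous; apply/derivable1_diffP.
    by have [] := dF _ x0.
  have c12 : forall x : R, 0 < x -> {for x, continuous (fun x => f1 x - f2 x)}.
    by move=> x x0; apply: cvgB; [exact: cf1|exact: cf2].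
  have FTC : (\int[mu]_(x in `[a n, b n]) (f1 x - f2 x)%:E =
      (F (b n))%:E - (F (a n))%:E)%E.
    apply: continuous_FTC2 => //; first exact: cw.
      split.
      - by move=> x /poso x0; have [] := dF _ x0.
      - by apply: cvg_at_right_filter; apply: cF.
      - by apply: cvg_at_left_filter; apply: cF; exact: lt_trans abn.
    by move=> x /poso x0; rewrite derive1E; have [_ ->] := dF _ x0.
  have int (f : R -> R) : (forall x : R, 0 < x -> {for x, continuous f}) ->
      mu.-integrable `[a n, b n] (fun x => (f x)%:E).
    by move=> cf; apply: continuous_compact_integrable;
      [exact: segment_compact|exact: cw].
  rewrite EFinB -FTC -integralD//=; [|exact: int|exact: (int _ c12)].
  by apply: eq_integral => x _; rewrite -EFinD addrC subrK.
rewrite (_ : (fun n => _) = (fun n => (\int[mu]_(x in `[a n, b n]) (f2 x)%:E +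
  (F (b n) - F (a n))%:E)%E)); last by apply/funext.
apply: cvgeD => //; last by apply: cvg_EFin; [exact: nearW|].
by rewrite fin_num_adde_defl.
Qed.

(** The offset 2 keeps the left endpoint strictly below the right one already at [n = 0], as
    [FTC_exhaustion] demands. The factor [k] makes this exhaustion the image of the one for 1 under
    multiplication by [k]. *)
Lemma itv0y_exhaustion (k : R) : 0 < k ->
  `]0, +oo[%classic = \bigcup_n `[k / n.+2%:R, k * n.+2%:R]%classic.
Proof.
move=> k0; apply/seteqP; split => x /=.
  rewrite in_itv/= andbT => x0.
  pose n := maxn (Num.truncn (k / x)) (Num.truncn (x / k)).
  exists n => //=; rewrite in_itv/= ler_pdivrMr ?ltr0n//.
  rewrite [x * _]mulrC -ler_pdivrMr// [k * _]mulrC -ler_pdivrMr//.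
  apply/andP; split.
    apply/ltW; apply: lt_le_trans (truncnS_gt _) _.
    by rewrite ler_nat ltnS; apply: leqW; exact: leq_maxl.
  apply/ltW; apply: lt_le_trans (truncnS_gt _) _.
  by rewrite ler_nat ltnS; apply: leqW; exact: leq_maxr.
move=> [n _ /=]; rewrite !in_itv/= andbT => /andP[+ _].
by apply: lt_le_trans; rewrite divr_gt0.
Qed.

Lemma itv0c_exhaustion (l : R) : 0 < l ->
  `]0, l]%classic = \bigcup_n `[l / n.+2%:R, l]%classic.
Proof.
move=> l0; apply/seteqP; split => x /=.
  rewrite in_itv/= => /andP[x0 xl].
  exists (Num.truncn (l / x)) => //=; rewrite in_itv/= ler_pdivrMr ?ltr0n// xl andbT.
  rewrite mulrC -ler_pdivrMr//.
  apply/ltW; apply: lt_le_trans (truncnS_gt _) _.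
  by rewrite ler_nat.
move=> [n _ /=]; rewrite !in_itv/= => /andP[+ ->]; rewrite andbT.
by apply: lt_le_trans; rewrite divr_gt0.
Qed.

Lemma itvcy_exhaustion (c : R) : 0 < c ->
  `[c, +oo[%classic = \bigcup_n `[c, c * n.+2%:R]%classic.
Proof.
move=> c0; apply/seteqP; split => x /=.
  rewrite in_itv/= andbT => cx.
  exists (Num.truncn (x / c)) => //=; rewrite in_itv/= cx /=.
  rewrite mulrC -ler_pdivrMr//.
  apply/ltW; apply: lt_le_trans (truncnS_gt _) _.
  by rewrite ler_nat.
by move=> [n _ /=]; rewrite !in_itv/= andbT => /andP[].
Qed.

Lemma nonincreasing_divS (k : R) : 0 < k ->
  nonincreasing_seq (fun n => k / n.+2%:R).
Proof. by move=> k0 m n mn; rewrite ler_pM2l// lef_pV2 ?posrE// ler_nat. Qed.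

Lemma nondecreasing_mulS (k : R) : 0 < k ->
  nondecreasing_seq (fun n => k * n.+2%:R).
Proof. by move=> k0 m n mn; rewrite ler_pM2l// ler_nat. Qed.

Lemma cvg_divS (k : R) : 0 < k -> (k / n.+2%:R) @[n --> \oo] --> 0^'+.
Proof.
move=> k0 A [e /= e0 eA].
exists (Num.truncn (k / e)) => //= n /= ne.
apply: eA => /=; last by rewrite divr_gt0.
rewrite sub0r normrN ger0_norm ?divr_ge0 ?(ltW k0)//.
rewrite ltr_pdivrMr ?ltr0n// mulrC -ltr_pdivrMr//.
apply: lt_le_trans (truncnS_gt _) _.
by rewrite ler_nat ltnS; apply: leqW.
Qed.

Lemma cvg_mulS (k : R) : 0 < k -> (k * n.+2%:R) @[n --> \oo] --> +oo.
Proof.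
move=> k0; apply/cvgryPge => M.
near=> n; rewrite mulrC -ler_pdivrMr//.
apply/ltW; apply: lt_le_trans (truncnS_gt _) _.
rewrite ler_nat ltnS; apply: leqW; near: n; exact: nbhs_infty_ge.
Unshelve. all: by end_near. Qed.

Lemma continuous_powR (r x : R) : 0 < x -> {for x, continuous (fun y : R => y `^ r)}.
Proof.
move=> x0; apply: differentiable_continuous; apply/derivable1_diffP.
by apply: derivable_powR; rewrite in_itv/= andbT.
Qed.

Lemma powR_cvgy (r : R) : 0 < r -> x `^ (- r) @[x --> +oo] --> 0.
Proof.
move=> r0; apply/cvgrPdist_le => e e0; near=> x.
have x0 : 0 < x by near: x; exact: nbhs_pinfty_gt.
rewrite sub0r normrN ger0_norm ?powR_ge0// powRN invf_ple ?posrE ?powR_gt0//.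
have -> : e^-1 = (e^-1 `^ r^-1) `^ r.
  by rewrite -powRrM mulVf ?gt_eqF// powRr1// invr_ge0 ltW.
have ex : e^-1 `^ r^-1 <= x.
  by near: x; apply: nbhs_pinfty_ge; exact: num_real.
by apply: ge0_ler_powR; rewrite ?nnegrE ?powR_ge0 ?(ltW r0) ?(ltW x0).
Unshelve. all: by end_near. Qed.

Lemma integral_powR_0c (r l : R) : 0 < r -> 0 < l ->
  (\int[mu]_(y in `]0%R, l]) (r * y `^ (r - 1))%:E = (l `^ r)%:E)%E.
Proof.
move=> r0 l0; rewrite (itv0c_exhaustion l0).
have -> : (l `^ r)%:E = (\int[mu]_(x in \bigcup_n `[(l / n.+2%:R)%R, l]%classic)
    ((fun=> 0) x)%:E + (l `^ r)%:E)%E by rewrite integral0 add0e.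
apply: (@FTC_exhaustion (fun y => r * y `^ (r - 1)) (fun=> 0) (fun y => y `^ r)).
- by move=> x x0; rewrite mulr_ge0 ?powR_ge0 ?ltW.
- by [].
- by move=> x x0; apply: cvgM; [exact: cvg_cst|exact: continuous_powR].
- by move=> x x0; exact: cvg_cst.
- by move=> x x0; rewrite subr0; exact: is_derive1_powR.
- move=> n; rewrite divr_gt0//= ltr_pdivrMr ?ltr0n// ltr_pMr//.
  by rewrite ltr1n.
- exact: nonincreasing_divS.
- by [].
- rewrite -[X in _ --> X]subr0; apply: cvgB; first exact: cvg_cst.
  exact: (cvg_comp (fun n => l / n.+2%:R) (fun y => y `^ r) (cvg_divS l0) (powR_cvg0 r0)).
Qed.

Lemma integral_powR_cy (r c : R) : 0 < r -> 0 < c ->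
  (\int[mu]_(y in `[c, +oo[) (r * y `^ (- r - 1))%:E = (c `^ (- r))%:E)%E.
Proof.
move=> r0 c0; rewrite (itvcy_exhaustion c0).
have -> : (c `^ (- r))%:E = (\int[mu]_(x in \bigcup_n `[c, (c * n.+2%:R)%R]%classic)
    ((fun=> 0) x)%:E + (c `^ (- r))%:E)%E by rewrite integral0 add0e.
apply: (@FTC_exhaustion (fun y => r * y `^ (- r - 1)) (fun=> 0)
  (fun y => - (y `^ (- r)))).
- by move=> x x0; rewrite mulr_ge0 ?powR_ge0 ?ltW.
- by [].
- by move=> x x0; apply: cvgM; [exact: cvg_cst|exact: continuous_powR].
- by move=> x x0; exact: cvg_cst.
- move=> x x0; rewrite subr0.
  rewrite -[r in X in is_derive _ _ _ X]opprK mulNr opprK.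
  by apply: is_deriveN; exact: is_derive1_powR.
- by move=> n; rewrite c0/= ltr_pMr// ltr1n.
- by [].
- exact: nondecreasing_mulS.
- rewrite -[X in _ --> X]add0r; under eq_fun do rewrite opprK.
  apply: cvgD; last exact: cvg_cst.
  rewrite -oppr0; apply: cvgN.
  exact: (cvg_comp (fun n => c * n.+2%:R) (fun y => y `^ (- r)) (cvg_mulS c0) (powR_cvgy r0)).
Qed.


(** On the range of integration [exp (- y)] lies between [exp (- l)] and 1, and [r y^(r - 1)]
    integrates to [l^r]. The two bounds give the equivalence with [l^r] at 0. *)
Lemma alpha_lower_incomplete_gamma (r l : R) : 0 < r -> 0 < l ->
  expR (- l) * l `^ r <= r * lower_incomplete_gamma r l <= l `^ r.
Proof.
move=> r0 l0.
have sub : `]0, l]%classic `<=` (`]0, +oo[%classic : set R).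
  by move=> x /=; rewrite !in_itv/= andbT => /andP[].
have m1 : measurable_fun `]0, l]%classic (fun y : R => r * y `^ (r - 1)).
  apply: continuous_gt0_measurable => // x x0.
  by apply: cvgM; [exact: cvg_cst|exact: continuous_powR].
have m2 : measurable_fun `]0, l]%classic (fun y : R => expR (- y) * y `^ (r - 1)).
  apply: continuous_gt0_measurable => // x x0.
  apply: cvgM; last exact: continuous_powR.
  by apply: continuous_comp; [exact: opp_continuous|exact: continuous_expR].
pose J := (\int[mu]_(y in `]0%R, l]) (expR (- y) * y `^ (r - 1))%:E)%E.
have rJ : (\int[mu]_(y in `]0%R, l]) (r%:E * (expR (- y) * y `^ (r - 1))%:E) =
    r%:E * J)%E.
  apply: ge0_integralZl_EFin => //; last exact: ltW.
  - by move=> x _; rewrite lee_fin mulr_ge0 ?expR_ge0 ?powR_ge0.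
  - exact/measurable_EFinP.
have rJ1 : (r%:E * J <= (l `^ r)%:E)%E.
  rewrite -rJ -integral_powR_0c//; apply: ge0_le_integral => //.
  - by move=> x _; rewrite lee_fin !mulr_ge0 ?expR_ge0 ?powR_ge0 ?ltW.
  - by apply/measurable_EFinP; apply: measurable_funM.
  - exact/measurable_EFinP.
  - move=> x /sub /=; rewrite in_itv/= andbT => x0.
    rewrite lee_fin ler_pM2l// ler_piMl ?powR_ge0//.
    by rewrite -expR0 ler_expR oppr_le0 ltW.
have rJ2 : ((expR (- l) * l `^ r)%:E <= r%:E * J)%E.
  rewrite -rJ EFinM -integral_powR_0c// -ge0_integralZl_EFin//.
  - apply: ge0_le_integral => //.
    + by move=> x _; rewrite lee_fin !mulr_ge0 ?expR_ge0 ?powR_ge0 ?ltW.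
    + by apply/measurable_EFinP; apply: measurable_funM.
    + by apply/measurable_EFinP; apply: measurable_funM.
    + move=> x /=; rewrite in_itv/= => /andP[x0 xl].
      rewrite lee_fin mulrCA ler_pM2l// ler_wpM2r ?powR_ge0//.
      by rewrite ler_expR lerN2.
  - by move=> x _; rewrite lee_fin !mulr_ge0 ?powR_ge0 ?ltW.
  - exact/measurable_EFinP.
have J0 : (0 <= J)%E.
  by apply: integral_ge0 => x _; rewrite lee_fin mulr_ge0 ?expR_ge0 ?powR_ge0.
(* [Rintegral] returns 0 on an infinite integral, so finiteness must precede the real-valued
   bounds. *)
have Jfin : (J \is a fin_num)%E.
  rewrite ge0_fin_numE// ltNge; apply/negP; rewrite leye_eq => /eqP Jy.
  by move: rJ1; rewrite Jy gt0_muley// ?lte_fin// leye_eq.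
rewrite /lower_incomplete_gamma /Rintegral -/J -!lee_fin [(r * _)%:E]EFinM fineK//.
by rewrite rJ1 rJ2.
Qed.

(** * Moments of the power-law density [beta x^(- beta - 1)] *)

Section gamma_moments.
Variable beta : R.
Hypotheses (beta0 : 0 < beta) (beta1 : beta < 1).
Implicit Types k x : R.

Lemma onem_expR_ge0 k x : 0 <= k -> 0 <= x -> 0 <= 1 - expR (- (k * x)).
Proof. by move=> k0 x0; rewrite subr_ge0 -expR0 ler_expR oppr_le0 mulr_ge0. Qed.

Lemma is_derive_expRNM k x : is_derive x 1 (fun y => expR (- (k * y))) (- k * expR (- (k * x))).
Proof.
have h : is_derive x 1 (fun y : R => - (k * y)) (- k).
  rewrite (_ : (fun _ => _) = (fun y => (- k) *: y)); last first.
    by apply/funext => y; rewrite /= -mulNr.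
  rewrite -[X in is_derive _ _ _ X]mulr1; exact: is_deriveZ.
by have := @is_derive1_comp _ expR _ x _ _ (is_derive_expR _) h; rewrite /comp mulrC.
Qed.

Lemma continuous_expRNM k : continuous (fun y => expR (- (k * y))).
Proof.
move=> x; apply: differentiable_continuous; apply/derivable1_diffP.
by have [] := is_derive_expRNM k x.
Qed.

(** Integration by parts. The boundary term [(1 - exp (- k x)) x^(-beta)] vanishes at 0, being at
    most [k x^(1 - beta)] with [beta < 1], and at infinity because [beta > 0]. *)
Lemma integral_onem_expR_powR k : 0 < k ->
  (\int[mu]_(x in `]0%R, +oo[) ((1 - expR (- (k * x))) * (beta * x `^ (- beta - 1)))%:E
   = \int[mu]_(x in `]0%R, +oo[) (k * expR (- (k * x)) * x `^ (- beta))%:E)%E.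
Proof.
move=> k0; rewrite (itv0y_exhaustion ltr01) -[RHS]adde0.
apply: (@FTC_exhaustion (fun x => (1 - expR (- (k * x))) * (beta * x `^ (- beta - 1)))
  (fun x => k * expR (- (k * x)) * x `^ (- beta))
  (fun x => - ((1 - expR (- (k * x))) * x `^ (- beta)))).
- move=> x x0; rewrite !mulr_ge0 ?powR_ge0 ?onem_expR_ge0 //; exact: ltW.
- by move=> x x0; rewrite !mulr_ge0 ?powR_ge0 ?expR_ge0 ?ltW.
- move=> x x0; apply: cvgM; first by
    apply: cvgB; [exact: cvg_cst|exact: continuous_expRNM].
  by apply: cvgM; [exact: cvg_cst|exact: continuous_powR].
- move=> x x0; apply: cvgM; last exact: continuous_powR.
  by apply: cvgM; [exact: cvg_cst|exact: continuous_expRNM].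
- move=> x x0.
  have h1 : is_derive x 1 (fun y => 1 - expR (- (k * y))) (k * expR (- (k * x))).
    have h := is_deriveB (is_derive_cst (1 : R) x 1) (is_derive_expRNM k x).
    apply: is_derive_eq h _; ring.
  have h2 := is_derive1_powR (- beta) x0.
  have := is_deriveN (is_deriveM h1 h2).
  rewrite /GRing.scale/= => h.
  apply: is_derive_eq h _; ring.
- move=> n; rewrite divr_gt0//= ltr_pdivrMr ?ltr0n// mul1r.
  rewrite -{1}[1]mulr1 ltr_pM// ?ltr1n //.
- exact: nonincreasing_divS.
- exact: nondecreasing_mulS.
rewrite (_ : 0 = - 0 - 0 :> R); last by rewrite !oppr0 addr0.
apply: cvgB; last first.
- suff h : - ((1 - expR (- (k * x))) * x `^ (- beta)) @[x --> (0:R)^'+] --> (0 : R).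
    exact: (cvg_comp _ _ (cvg_divS ltr01) h).
  rewrite -[X in _ --> X]oppr0; apply: cvgN.
  apply: (@squeeze_cvgr _ _ _ _ (fun=> 0) (fun x => k * x `^ (1 - beta))).
  + near=> x; have x0 : 0 < x by near: x; exact: nbhs_right_gt.
    rewrite mulr_ge0 ?powR_ge0 ?onem_expR_ge0 ?(ltW k0) ?(ltW x0)//=.
    rewrite powRD; last by rewrite (gt_eqF x0) implybT.
    rewrite powRr1 ?(ltW x0)// mulrA ler_wpM2r ?powR_ge0//.
    by have := expR_ge1Dx (- (k * x)); lra.
  + exact: cvg_cst.
  + rewrite -[X in _ --> X](mulr0 k); apply: cvgM; first exact: cvg_cst.
    have b1 : 0 < 1 - beta by rewrite subr_gt0.
    exact: (powR_cvg0 b1).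
- suff h : - ((1 - expR (- (k * x))) * x `^ (- beta)) @[x --> +oo] --> - (0 : R).
    exact: (cvg_comp _ _ (cvg_mulS ltr01) h).
  apply: cvgN.
  apply: (@squeeze_cvgr _ _ _ _ (fun=> 0) (fun x => x `^ (- beta))).
  + near=> x; have x0 : 0 < x by near: x; exact: nbhs_pinfty_gt.
    rewrite mulr_ge0 ?powR_ge0 ?onem_expR_ge0 ?(ltW k0) ?(ltW x0)//=.
    by rewrite ler_piMl ?powR_ge0// gerBl expR_ge0.
  + exact: cvg_cst.
  + exact: powR_cvgy.
Unshelve. all: by end_near. Qed.

(** The substitution [y = k x], made on the compact pieces of the exhaustion for 1, whose images are
    the pieces of the exhaustion for [k]. *)
Lemma integral_expR_powR_scale k : 0 < k ->
  (\int[mu]_(x in `]0%R, +oo[) (k * expR (- (k * x)) * x `^ (- beta))%:E =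
   (k `^ beta)%:E * \int[mu]_(x in `]0%R, +oo[) (expR (- x) * x `^ (- beta))%:E)%E.
Proof.
move=> k0.
pose f x := k * expR (- (k * x)) * x `^ (- beta).
pose g x := expR (- x) * x `^ (- beta).
have cf x : 0 < x -> {for x, continuous f}.
  move=> x0; apply: cvgM; last exact: continuous_powR.
  by apply: cvgM; [exact: cvg_cst|exact: continuous_expRNM].
have cg x : 0 < x -> {for x, continuous g}.
  move=> x0; apply: cvgM; last exact: continuous_powR.
  by apply: continuous_comp; [exact: opp_continuous|exact: continuous_expR].
have f0 x : 0 < x -> 0 <= f x.
  by move=> x0; rewrite !mulr_ge0 ?powR_ge0 ?expR_ge0 ?ltW.
have g0 x : 0 < x -> 0 <= g x.
  by move=> x0; rewrite !mulr_ge0 ?powR_ge0 ?expR_ge0 ?ltW.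
have d0 (c : R) : 0 < c -> forall n : nat, 0 < c / n.+2%:R.
  by move=> c0 n; rewrite divr_gt0.
have h1 := cvg_integral_exhaustion f0 cf (d0 _ ltr01) (nonincreasing_divS ltr01)
  (nondecreasing_mulS ltr01).
have h2 := cvg_integral_exhaustion g0 cg (d0 _ k0) (nonincreasing_divS k0)
  (nondecreasing_mulS k0).
rewrite -(itv0y_exhaustion ltr01) in h1.
rewrite -(itv0y_exhaustion k0) in h2.
apply: (cvg_unique _ h1) => //.
suff E : (fun n : nat => \int[mu]_(x in `[(1 / n.+2%:R)%R, (1 * n.+2%:R)%R]) (f x)%:E)%E
    = (fun n : nat => (k `^ beta)%:E *
        \int[mu]_(x in `[(k / n.+2%:R)%R, (k * n.+2%:R)%R]) (g x)%:E)%E.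
  by rewrite E; exact: cvgeZl h2.
apply/funext => n.
have n2 : 0 < n.+2%:R :> R by [].
have n21 : 1 / n.+2%:R <= 1 * n.+2%:R :> R.
  by rewrite ler_pdivrMr// mul1r -natrM ler1n.
have dk : (fun x => k * x)^`()%classic = fun=> k.
  apply/funext => x; rewrite derive1E.
  have : is_derive x (1 : R) (fun y : R => k *: y) (k *: 1) by exact: is_deriveZ.
  by rewrite /GRing.scale/= mulr1 => -[].
(* Displays the endpoints as images under multiplication by [k], the form that the substitution rule
   matches. *)
have mk x : k * (1 * x) = k * x by rewrite mul1r.
rewrite -mk -(mk n.+2%:R) (integration_by_substitution_increasing n21).
- rewrite dk -ge0_integralZl_EFin//.
  + apply: eq_integral => x /[!inE]; rewrite /= in_itv/= => /andP[xn _].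
    have x0 : 0 < x by apply: lt_le_trans xn; rewrite divr_gt0.
    rewrite -EFinM; congr EFin.
    have -> : ((g \o *%R k) * (fun=> k)) x = expR (- (k * x)) * (k * x) `^ (- beta) * k by [].
    rewrite /f powRM ?(ltW k0) ?(ltW x0)//.
    rewrite [k `^ (- beta)]powRN.
    by field; rewrite gt_eqF ?powR_gt0.
  + move=> x /=; rewrite in_itv/= => /andP[xn _].
    have x0 : 0 < x by apply: lt_le_trans xn; rewrite divr_gt0.
    by rewrite lee_fin mulr_ge0 ?g0 ?mulr_gt0 ?(ltW k0).
  + apply/measurable_EFinP; apply: continuous_gt0_measurable => //.
      by move=> x /=; rewrite !in_itv/= andbT => /andP[+ _]; apply: lt_le_trans; rewrite divr_gt0.
    move=> x x0; apply: cvgM; last exact: cvg_cst.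
    apply: (@continuous_comp _ _ _ (fun x => k * x) g).
      by apply: cvgM; [exact: cvg_cst|exact: cvg_id].
    by apply: cg; rewrite mulr_gt0.
  + exact: powR_ge0.
- by move=> x y _ _ xy; rewrite ltr_pM2l.
- by rewrite dk => x _; exact: cvg_cst.
- by rewrite dk; exact: is_cvg_cst.
- by rewrite dk; exact: is_cvg_cst.
- have ck : continuous (fun x => k * x).
    by move=> x; apply: cvgM; [exact: cvg_cst|exact: cvg_id].
  split.
  + move=> x _; apply/derivable1_diffP.
    have : is_derive x (1 : R) (fun y : R => k *: y) (k *: 1) by exact: is_deriveZ.
    by rewrite /GRing.scale/= => -[] /derivable1_diffP.
  + by apply: cvg_at_right_filter; exact: ck.
  + by apply: cvg_at_left_filter; exact: ck.
- apply: continuous_in_subspaceT => x; rewrite inE/= in_itv/= => /andP[xn _].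
  by apply: cg; apply: lt_le_trans xn; rewrite mulr_gt0 ?divr_gt0 ?mulr_gt0.
Qed.

Let gamma_int := (\int[mu]_(x in `]0%R, +oo[) (expR (- x) * x `^ (- beta))%:E)%E.

(** Finiteness is read off the integrated-by-parts form with [k = 1]:
    [(1 - exp (- x)) beta x^(- beta - 1)] is at most [beta x^(-beta)] up to 1 and at most
    [beta x^(- beta - 1)] beyond, so only powers are integrated. Positivity comes from
    [exp (- x) >= exp (- 1)] up to 1. *)
Lemma gamma_int_bounds : (0 < gamma_int < +oo)%E.
Proof.
have cg x : 0 < x -> {for x, continuous (fun x => expR (- x) * x `^ (- beta))}.
  move=> x0; apply: cvgM; last exact: continuous_powR.
  by apply: continuous_comp; [exact: opp_continuous|exact: continuous_expR].
have cr r x : 0 < x -> {for x, continuous (fun x => beta * x `^ r)}.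
  by move=> x0; apply: cvgM; [exact: cvg_cst|exact: continuous_powR].
have b1 : 0 < 1 - beta by rewrite subr_gt0.
have b1E : 1 - beta - 1 = - beta by ring.
apply/andP; split.
  have low : ((expR (-1) / (1 - beta))%:E <= gamma_int)%E.
    have -> : (expR (-1) / (1 - beta))%:E = (\int[mu]_(y in `]0%R, 1%R])
       ((expR (-1) / (1 - beta))%:E * ((1 - beta) * y `^ (1 - beta - 1))%:E))%E.
      rewrite ge0_integralZl_EFin//.
      - by rewrite integral_powR_0c// powR1 mule1.
      - by move=> x _; rewrite lee_fin mulr_ge0 ?powR_ge0 ?ltW.
      - apply/measurable_EFinP; apply: continuous_gt0_measurable => //.
          by move=> x /=; rewrite !in_itv/= andbT => /andP[].
        by move=> x x0; apply: cvgM; [exact: cvg_cst|exact: continuous_powR].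
      - by rewrite divr_ge0 ?expR_ge0 ?ltW.
    apply: (@le_trans _ _ (\int[mu]_(x in `]0%R, 1%R]) (expR (- x) * x `^ (- beta))%:E)%E).
      have sub : `]0, 1]%classic `<=` (`]0, +oo[%classic : set R).
        by move=> x /=; rewrite !in_itv/= andbT => /andP[].
      apply: ge0_le_integral => //.
      - by move=> x _; rewrite -EFinM lee_fin !mulr_ge0 ?powR_ge0 ?expR_ge0 ?invr_ge0 ?ltW.
      - apply: emeasurable_funM; first exact: measurable_cst.
        apply/measurable_EFinP; apply: continuous_gt0_measurable => // x x0.
        by apply: cvgM; [exact: cvg_cst|exact: continuous_powR].
      - by apply/measurable_EFinP; exact: continuous_gt0_measurable.
      - move=> x /=; rewrite in_itv/= => /andP[x0 x1].
        rewrite -EFinM lee_fin mulrA divfK ?gt_eqF// b1E ler_wpM2r ?powR_ge0//.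
        by rewrite ler_expR lerN2.
    apply: ge0_subset_integral => //.
    - by apply/measurable_EFinP; exact: continuous_gt0_measurable.
    - by move=> x _; rewrite lee_fin mulr_ge0 ?powR_ge0 ?expR_ge0.
    - by move=> x /=; rewrite !in_itv/= andbT => /andP[].
  by apply: lt_le_trans low; rewrite lte_fin divr_gt0 ?expR_gt0.
have E := integral_onem_expR_powR ltr01.
rewrite (integral_expR_powR_scale ltr01) powR1 mul1e in E.
rewrite /gamma_int -E.
set h := fun x => ((1 - expR (- (1 * x))) * (beta * x `^ (- beta - 1)))%:E.
have mh (D : set R) : measurable D -> D `<=` `]0, +oo[%classic -> measurable_fun D h.
  move=> mD sub; apply/measurable_EFinP; apply: continuous_gt0_measurable => // x x0.
  apply: cvgM; last exact: cr.
  by apply: cvgB; [exact: cvg_cst|exact: continuous_expRNM].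
have h0 x : 0 < x -> (0 <= h x)%E.
  by move=> x0; rewrite lee_fin !mulr_ge0 ?powR_ge0 ?onem_expR_ge0 ?(ltW beta0) ?(ltW x0).
have -> : `]0, +oo[%classic = `]0, 1]%classic `|` `]1, +oo[%classic :> set R.
  apply/seteqP; split => x /=; rewrite !in_itv/= !andbT.
    by move=> x0; case: (leP x 1) => [x1|]; [left; rewrite x0|right].
  by move=> [/andP[]//|]; apply: lt_trans.
have sub1 : `]0, 1]%classic `<=` (`]0, +oo[%classic : set R).
  by move=> x /=; rewrite !in_itv/= andbT => /andP[].
have sub2 : `[1, +oo[%classic `<=` (`]0, +oo[%classic : set R).
  by move=> x /=; rewrite !in_itv/= !andbT; apply: lt_le_trans.
have sub3 : `]1, +oo[%classic `<=` (`]0, +oo[%classic : set R).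
  by move=> x /=; rewrite !in_itv/= !andbT; apply: lt_trans.
have subU : `]0, 1]%classic `|` `]1, +oo[%classic `<=` (`]0, +oo[%classic : set R).
  by move=> x [/sub1//|/sub3].
rewrite ge0_integral_setU//=; last 3 first.
- by apply: mh => //; exact: measurableU.
- by move=> x /subU /=; rewrite in_itv/= andbT; exact: h0.
- apply/disj_setPRL => x /=; rewrite !in_itv/= andbT => x1 /andP[_].
  by rewrite leNgt x1.
apply: lte_add_pinfty.
- apply: (@le_lt_trans _ _ (\int[mu]_(x in `]0%R, 1%R])
       ((beta / (1 - beta))%:E * ((1 - beta) * x `^ (1 - beta - 1))%:E))%E).
    apply: ge0_le_integral => //.
    + by move=> x /sub1 /=; rewrite in_itv/= andbT; exact: h0.
    + exact: mh.
    + apply: emeasurable_funM; first exact: measurable_cst.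
      apply/measurable_EFinP; apply: continuous_gt0_measurable => // x x0.
      by apply: cvgM; [exact: cvg_cst|exact: continuous_powR].
    + move=> x /=; rewrite in_itv/= => /andP[x0 x1].
      rewrite -EFinM lee_fin [X in _ <= X]mulrA divfK ?gt_eqF// mulrCA ler_pM2l//.
      rewrite b1E powRB; last by rewrite (gt_eqF x0) implybT.
      rewrite powRr1 ?(ltW x0)// mulrCA ler_piMr ?powR_ge0//.
      rewrite ler_pdivrMr// mul1r.
      by have := expR_ge1Dx (- x); lra.
  rewrite ge0_integralZl_EFin//.
  - by rewrite integral_powR_0c// -EFinM ltry.
  - by move=> x _; rewrite lee_fin mulr_ge0 ?powR_ge0 ?ltW.
  - apply/measurable_EFinP; apply: continuous_gt0_measurable => // x x0.
    by apply: cvgM; [exact: cvg_cst|exact: continuous_powR].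
  - by rewrite divr_ge0 ?ltW.
- apply: (@le_lt_trans _ _ (\int[mu]_(x in `[1%R, +oo[) (beta * x `^ (- beta - 1))%:E)%E).
    apply: (@le_trans _ _ (\int[mu]_(x in `[1%R, +oo[) h x)%E).
      apply: ge0_subset_integral => //.
      + exact: mh.
      + by move=> x /sub2 /=; rewrite in_itv/= andbT; exact: h0.
      + by move=> x /=; rewrite !in_itv/= !andbT => /ltW.
    apply: ge0_le_integral => //.
    + by move=> x /sub2 /=; rewrite in_itv/= andbT; exact: h0.
    + exact: mh.
    + by apply/measurable_EFinP; apply: continuous_gt0_measurable => // x; exact: cr.
    + by move=> x _; rewrite lee_fin ler_piMl ?mulr_ge0 ?powR_ge0 ?(ltW beta0).
  by rewrite integral_powR_cy// ltry.
Qed.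

Lemma Gamma_onem_gt0 : 0 < Gamma (1 - beta).
Proof.
rewrite /Gamma /Rintegral (_ : 1 - beta - 1 = - beta); last by ring.
by apply: fine_gt0; exact: gamma_int_bounds.
Qed.

(** Up to the factor [Gamma (1 - beta)], the Lévy-Khintchine formula of the stable subordinator of
    index [beta]. Integrability is recorded because two such integrals are subtracted later. *)
Lemma Rintegral_onem_expR_powR k : 0 < k ->
  mu.-integrable `]0, +oo[
    (EFin \o (fun x => (1 - expR (- (k * x))) * (beta * x `^ (- beta - 1)))) /\
  (\int[mu]_(x in `]0%R, +oo[) ((1 - expR (- (k * x))) * (beta * x `^ (- beta - 1)))
   = k `^ beta * Gamma (1 - beta))%R.
Proof.
move=> k0.
have E := integral_onem_expR_powR k0.
rewrite (integral_expR_powR_scale k0) in E.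
have /andP[g0 gy] := gamma_int_bounds.
split.
  apply/integrableP; split.
    apply/measurable_EFinP; apply: continuous_gt0_measurable => // x x0.
    apply: cvgM; first by apply: cvgB; [exact: cvg_cst|exact: continuous_expRNM].
    by apply: cvgM; [exact: cvg_cst|exact: continuous_powR].
  under eq_integral => x.
    rewrite inE/= in_itv/= andbT => x0.
    rewrite ger0_norm ?mulr_ge0 ?powR_ge0 ?onem_expR_ge0 ?(ltW beta0) ?(ltW x0) ?(ltW k0)//.
    over.
  by rewrite E; apply: lte_mul_pinfty; rewrite ?lee_fin ?powR_ge0.
rewrite /Rintegral E /Gamma /Rintegral (_ : 1 - beta - 1 = - beta); last by ring.
by rewrite fineM// ge0_fin_numE ?(ltW g0).
Qed.

End gamma_moments.

End improper_integrals.

(** * Passage to the limit in expectations *)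

Section integral_limits.
Context d (T : measurableType d) (R : realType).

(** Fatou's lemma with bounds that converge instead of being fixed: in the lower estimate below, the
    bound itself contains the integrals whose limit is known. *)
Lemma fatou_bound (mu : {measure set T -> \bar R}) (D : set T)
    (v_ : nat -> T -> R) (v : T -> R) (B : nat -> \bar R) (b : \bar R) :
  measurable D -> (forall n, measurable_fun D (v_ n)) ->
  (forall n w, D w -> 0 <= v_ n w) ->
  (forall w, D w -> v_ n w @[n --> \oo] --> v w) ->
  (forall n, (\int[mu]_(w in D) (v_ n w)%:E <= B n)%E) -> B @ \oo --> b ->
  (\int[mu]_(w in D) (v w)%:E <= b)%E.
Proof.
move=> mD mv v0 vv vB Bb.
have -> : (\int[mu]_(w in D) (v w)%:E =
    \int[mu]_(w in D) limn_einf (fun n => (v_ n w)%:E))%E.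
  apply: eq_integral => w /[!inE] Dw.
  have h : (fun n => (v_ n w)%:E) @ \oo --> (v w)%:E.
    by apply: cvg_EFin; [exact: nearW|exact: vv].
  by have [-> _] := cvg_limn_einf_sup h.
apply: le_trans (fatou mu mD _ _) _.
- by move=> n; apply/measurable_EFinP.
- by move=> n w Dw; rewrite lee_fin v0.
rewrite limn_einf_lim; apply: lime_le; first exact: is_cvg_einfs.
apply: nearW => n.
have h : (fun m => B (m + n)%N) @ \oo --> b by rewrite cvg_shiftn.
rewrite -(cvg_lim _ h)//; apply: lime_ge; first by apply/cvg_ex; exists b.
apply: nearW => m; apply: le_trans (vB _).
by apply: ereal_inf_lbound; exists (m + n)%N => //=; rewrite leq_addl.
Qed.

(* Applying Fatou's lemma to [u_ n] and to the nonnegative functions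
   [e (u_ n)^2 - u_ n + 1 / (4 e)] bounds the limit from both sides. *)
Lemma cvg_integral_L2_bounded (P : probability T R) (u_ : nat -> T -> R)
    (u : T -> R) (K m : R) :
  (forall n, measurable_fun setT (u_ n)) -> measurable_fun setT u ->
  (forall n w, 0 <= u_ n w) -> (forall w, 0 <= u w) ->
  {ae P, forall w, u_ n w @[n --> \oo] --> u w} ->
  (forall n, (\int[P]_w ((u_ n w) ^+ 2)%:E <= K%:E)%E) ->
  (\int[P]_w (u_ n w)%:E @[n --> \oo] --> m%:E)%E ->
  (\int[P]_w (u w)%:E = m%:E)%E.
Proof.
move=> mu_ mu u_0 u0 uu uK um.
have [N [mN N0 subN]] := uu.
(* On [D] the convergence holds at every point, as [fatou_bound] requires, and the integrals do not
   notice the removed null set. *)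
pose D := ~` N.
have mD : measurable D by exact: measurableC.
have intD (f : T -> R) : measurable_fun setT f -> (forall w, 0 <= f w) ->
    (\int[P]_w (f w)%:E = \int[P]_(w in D) (f w)%:E)%E.
  move=> mf f0; rewrite (ge0_negligible_integral mN) ?setTD//.
  - exact/measurable_EFinP.
  - by move=> w _; rewrite lee_fin.
have PD : P D = 1%E by rewrite /D probability_setC// N0 sube0.
have mS : forall g : T -> R, measurable_fun setT g -> measurable_fun D g.
  by move=> g; exact: measurable_funTS.
have cD w : D w -> u_ n w @[n --> \oo] --> u w.
  by move=> Dw; apply: contrapT => h; apply: Dw; exact: subN.
pose U n := (\int[P]_(w in D) (u_ n w)%:E)%E.
have Um : U @ \oo --> m%:E.
  rewrite (_ : U = fun n => \int[P]_w (u_ n w)%:E)%E//.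
  by apply/funext => n; rewrite intD.
have um_le : (\int[P]_(w in D) (u w)%:E <= m%:E)%E.
  apply: (@fatou_bound P D u_ u U) => //.
  by move=> n; exact: mS.
have uD0 : (0 <= \int[P]_(w in D) (u w)%:E)%E.
  by apply: integral_ge0 => w _; rewrite lee_fin.
have [I IE] : exists I : R, (\int[P]_(w in D) (u w)%:E = I%:E)%E.
  exists (fine (\int[P]_(w in D) (u w)%:E)%E); rewrite fineK// ge0_fin_numE//.
  exact: le_lt_trans um_le (ltry _).
rewrite intD// IE; rewrite IE in um_le uD0; congr EFin.
apply/eqP; rewrite eq_le; apply/andP; split; first by rewrite -lee_fin.
apply/ler_addgt0Pr => e e0.
have K0 : 0 <= K.
  rewrite -lee_fin; apply: le_trans (uK 0%N).
  by apply: integral_ge0 => w _; rewrite lee_fin sqr_ge0.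
(* [r] is small enough that [r * K <= e]; the constant [q] then completes the square in [f], whence
   [f >= 0]. *)
pose r := e / (K + 1).
have r0 : 0 < r by rewrite divr_gt0// ltr_wpDl.
have rK : r * K <= e.
  by rewrite /r mulrAC ler_pdivrMr ?ltr_wpDl// mulrDr mulr1 lerDl ltW.
pose q := 4^-1 / r.
have q0 : 0 < q by rewrite divr_gt0.
pose f (x : R) := r * x ^+ 2 - x + q.
have f0 x : 0 <= f x.
  rewrite /f (_ : _ + q = (2 * r * x - 1) ^+ 2 * q); last by rewrite /q; field; rewrite gt_eqF.
  by rewrite mulr_ge0 ?sqr_ge0// ltW.
have mf (g : T -> R) : measurable_fun setT g -> measurable_fun setT (fun w : T => f (g w)).
  move=> mg; apply: measurable_funD => //; apply: measurable_funB => //.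
  by apply: measurable_funM => //; exact: measurable_funX.
have fq (g : T -> R) : measurable_fun setT g -> (forall w, 0 <= g w) ->
  (\int[P]_(w in D) (f (g w))%:E + \int[P]_(w in D) (g w)%:E =
   r%:E * \int[P]_(w in D) (g w ^+ 2)%:E + q%:E)%E.
  move=> mg g0; rewrite -ge0_integralD//=; first last.
  - by apply/measurable_EFinP; exact: mS.
  - by move=> w _; rewrite lee_fin.
  - by apply/measurable_EFinP; apply: mS; exact: mf.
  - by move=> w _; rewrite lee_fin.
  rewrite -ge0_integralZl_EFin//; first last.
  - exact: ltW.
  - by apply/measurable_EFinP; apply: mS; exact: measurable_funX.
  - by move=> w _; rewrite lee_fin sqr_ge0.
  have -> : q%:E = (\int[P]_(w in D) (cst q%:E) w)%E.
    rewrite integral_cst// -[LHS]mule1; congr (_ * _)%E; exact/esym/PD.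
  rewrite -ge0_integralD//=.
  - by apply: eq_integral => w _; rewrite -EFinM -!EFinD; congr EFin; rewrite /f; ring.
  - by move=> w _; rewrite -EFinM lee_fin mulr_ge0 ?sqr_ge0 ?ltW.
  - apply: emeasurable_funM; first exact: measurable_cst.
    by apply/measurable_EFinP; apply: mS; exact: measurable_funX.
  - by move=> w _; rewrite lee_fin ltW.
have h := @fatou_bound P D (fun n w => f (u_ n w)) (fun w => f (u w))
  (fun n => (r * K + q)%:E - U n)%E ((r * K + q)%:E - m%:E)%E mD.
have {h} : (\int[P]_(w in D) (f (u w))%:E <= (r * K + q)%:E - m%:E)%E.
  apply: h.
  - by move=> n; apply: mS; exact: mf.
  - by move=> n w _; exact: f0.
  - move=> w Dw; apply: cvgD; last exact: cvg_cst.
    apply: cvgB; last exact: cD.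
    by apply: cvgM; [exact: cvg_cst|rewrite expr2; apply: cvgM; exact: cD].
  - move=> n.
    have : (\int[P]_(w in D) (f (u_ n w))%:E + U n <= (r * K + q)%:E)%E.
      rewrite fq// EFinD leeD2r// [(r * K)%:E]EFinM lee_pmul2l// -intD//.
      - exact: measurable_funX.
      - by move=> w; rewrite sqr_ge0.
    have U0 : (0 <= U n)%E by apply: integral_ge0 => w _; rewrite lee_fin.
    have V0 : (0 <= \int[P]_(w in D) (f (u_ n w))%:E)%E.
      by apply: integral_ge0 => w _; rewrite lee_fin.
    move=> h; have Ufin : (U n \is a fin_num)%E.
      rewrite ge0_fin_numE//; apply: (@le_lt_trans _ _ (r * K + q)%:E); last exact: ltry.
      by apply: le_trans h; rewrite leeDr.
    by rewrite leeBrDr.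
  - by apply: cvgeB => //; exact: cvg_cst.
have := fq u mu u0; rewrite IE => fqu h.
have : (r%:E * \int[P]_(w in D) (u w ^+ 2)%:E + q%:E <= (r * K + q)%:E - m%:E + I%:E)%E.
  by rewrite -fqu leeD2r.
(* Once the nonnegative integral of [u^2] is dropped, what remains is [m <= I + r * K]. *)
have q_le : (q%:E <= r%:E * \int[P]_(w in D) (u w ^+ 2)%:E + q%:E)%E.
  rewrite leeDr// mule_ge0// ?lee_fin ?(ltW r0)//.
  by apply: integral_ge0 => w _; rewrite lee_fin sqr_ge0.
move/(le_trans q_le); rewrite -!EFinD lee_fin; lra.
Qed.

End integral_limits.

(** * Laplace transform of the subordinated process *)

Section subordination.
Context d (T : measurableType d) (R : realType) (P : probability T R).
Implicit Types X Y S Q : R -> {RV P >-> R}.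

Lemma ge0_integral_mrestr (mu : {measure set T -> \bar R}) (A : set T)
    (mA : measurable A) (f : T -> \bar R) :
  measurable_fun setT f -> (forall w, (0 <= f w)%E) ->
  (\int[mrestr mu mA]_w f w = \int[mu]_(w in A) f w)%E.
Proof.
move=> mf f0; rewrite -(setUv A) ge0_integral_setU//.
- rewrite [X in (_ + X)%E]null_set_integral ?adde0.
  + apply: eq_measure_integral => B mB BA.
    by rewrite /= /mrestr setIidl.
  + exact: measurableC.
  + exact: measurable_funTS.
  + by rewrite /= /mrestr setICl measure0.
- exact: measurableC.
- by rewrite setUv.
- by rewrite disj_set2E setICr.
Qed.

(** Independence says that the image under [X] of [P] restricted to [A] is [P A] times the law of
    [X]. Comparing these two measures avoids approximating [phi] by simple functions. *)
Lemma independent_integral (X : {RV P >-> R}) (A : set T) (phi : R -> R) :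
  measurable A ->
  (forall B, measurable B -> P (X @^-1` B `&` A) = (P (X @^-1` B) * P A)%E) ->
  measurable_fun setT phi -> (forall x, 0 <= phi x) ->
  (\int[P]_(w in A) (phi (X w))%:E = P A * \int[P]_w (phi (X w))%:E)%E.
Proof.
move=> mA ind mphi phi0.
have mf : measurable_fun setT (EFin \o phi) by exact/measurable_EFinP.
have mX : measurable_fun setT X by exact: measurable_funP.
have PA0 : 0 <= fine (P A) by rewrite fine_ge0.
rewrite -(ge0_integral_mrestr P mA); first last.
- by move=> w; rewrite lee_fin.
- by apply/measurable_EFinP; exact: measurableT_comp.
have -> : (P A = (NngNum PA0)%:num%:E)%E by rewrite /= fineK// fin_num_measure.
rewrite -(ge0_integral_pushforward mX (mrestr P mA) measurableT mf)//.
rewrite -(ge0_integral_pushforward mX P measurableT mf)//.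
rewrite -ge0_integral_mscale//.
apply: eq_measure_integral => B mB _.
rewrite /= /mscale/= /pushforward /mrestr fineK ?fin_num_measure//.
- by rewrite ind// muleC.
- by move=> x _; rewrite lee_fin.
- by move=> x _; rewrite lee_fin.
- by move=> x _; rewrite lee_fin.
Qed.

(** Lies strictly to the right of its argument even at grid points, so that right limits of the
    paths of [Y] apply. Negative arguments go to [1 / n.+1], so every value is an admissible
    time. *)
Definition next_grid (n : nat) (x : R) : R :=
  (Num.truncn (n.+1%:R * x)).+1%:R / n.+1%:R.

Lemma next_grid_gt n x : x < next_grid n x.
Proof.
rewrite /next_grid ltr_pdivlMr ?ltr0n// mulrC.
exact: truncnS_gt.
Qed.

Lemma next_grid_le n x : 0 <= x -> next_grid n x <= x + n.+1%:R^-1.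
Proof.
move=> x0; rewrite /next_grid ler_pdivrMr ?ltr0n// mulrDl mulVf ?pnatr_eq0//.
rewrite -natr1 lerD2r [x * _]mulrC.
by have /truncn_itv/andP[] : 0 <= n.+1%:R * x by rewrite mulr_ge0.
Qed.

Lemma cvg_next_grid x : 0 <= x -> next_grid n x @[n --> \oo] --> x.
Proof.
move=> x0; apply: (@squeeze_cvgr _ _ _ _ (fun=> x) (fun n => x + n.+1%:R^-1)).
- by apply: nearW => n; rewrite ltW ?next_grid_gt//= next_grid_le.
- exact: cvg_cst.
- rewrite -[X in _ --> X]addr0; apply: cvgD; first exact: cvg_cst.
  exact: cvg_harmonic.
Qed.

Definition grid_cell (n k : nat) : set R :=
  [set x | Num.truncn (n.+1%:R * x) = k].

Lemma measurable_grid_cell n k : measurable (grid_cell n k).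
Proof.
have mle m : measurable [set x : R | (Num.truncn (n.+1%:R * x) <= m)%N].
  rewrite [X in measurable X](_ : _ = `]-oo, m.+1%:R / n.+1%:R[%classic).
    exact: measurable_itv.
  apply/seteqP; split => x /=; rewrite in_itv/= ltr_pdivlMr ?ltr0n// mulrC truncn_le_nat//.
case: k => [|k].
  rewrite [X in measurable X](_ : _ = [set x : R | (Num.truncn (n.+1%:R * x) <= 0)%N]) //.
  by apply/seteqP; split => x /=; rewrite /grid_cell/= leqn0 => /eqP.
rewrite [X in measurable X](_ : _ = [set x : R | (Num.truncn (n.+1%:R * x) <= k.+1)%N] `\`
   [set x : R | (Num.truncn (n.+1%:R * x) <= k)%N]).
  exact: measurableD.
apply/seteqP; split => x /=; rewrite /grid_cell/=.
  by move=> ->; rewrite leqnn ltnn.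
by move=> [h1 /negP]; rewrite -ltnNge => h2; apply/eqP; rewrite eqn_leq h1 h2.
Qed.

Lemma bigcup_grid_cell n : \bigcup_k grid_cell n k = setT.
Proof.
by apply/seteqP; split => // x _; exists (Num.truncn (n.+1%:R * x)).
Qed.

Lemma measurable_next_grid n : measurable_fun setT (next_grid n).
Proof.
rewrite -(bigcup_grid_cell n); apply/measurable_fun_bigcup => [k|k].
  exact: measurable_grid_cell.
apply: (eq_measurable_fun (cst (k.+1%:R / n.+1%:R : R))).
  by move=> x /[!inE]; rewrite /grid_cell/= /next_grid => ->.
exact: measurable_cst.
Qed.

(** On each cell of [S t] the time is a constant [s k], and the cell is an event of [S], hence
    independent of [Y (s k)]. Countably many cells give both the measurability and, by summation,
    the formula with the time frozen. *)
Lemma integral_next_grid Y S (t : R) (phi : R -> R) n : 0 <= t ->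
  independent_processes Y S ->
  measurable_fun setT phi -> (forall x, 0 <= phi x) ->
  measurable_fun setT (fun w => phi (Y (next_grid n (S t w)) w)) /\
  (\int[P]_w (phi (Y (next_grid n (S t w)) w))%:E =
   \int[P]_w (fun s => \int[P]_w' (phi (Y s w'))%:E) (next_grid n (S t w)))%E.
Proof.
move=> t0 ind mphi phi0.
pose A k := S t @^-1` grid_cell n k.
pose s k : R := k.+1%:R / n.+1%:R.
have mA k : measurable (A k).
  have mS : measurable_fun setT (S t) by exact: measurable_funP.
  rewrite -[A k]setTI; apply: mS => //.
  exact: measurable_grid_cell.
have AE k w : A k w -> next_grid n (S t w) = s k by rewrite /A/= /next_grid => ->.
have AU : \bigcup_k A k = setT.
  apply/seteqP; split => // w _.
  by exists (Num.truncn (n.+1%:R * S t w)).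
have tA : trivIset setT A.
  apply/trivIsetP => i j _ _ ij; apply/seteqP; split => // w [Ai Aj].
  have Ei : Num.truncn (n.+1%:R * S t w) = i := Ai.
  have Ej : Num.truncn (n.+1%:R * S t w) = j := Aj.
  by move: ij; rewrite -Ei -Ej eqxx.
have mphiY r : measurable_fun setT (fun w => phi (Y r w)).
  exact: measurableT_comp.
have mf : measurable_fun setT (fun w => phi (Y (next_grid n (S t w)) w)).
  rewrite -AU; apply/measurable_fun_bigcup => // k.
  apply: (@eq_measurable_fun _ _ _ _ _ (fun w => phi (Y (s k) w))).
    by move=> w /[!inE] Aw; rewrite (AE k w Aw).
  exact: measurable_funTS.
split => //.
have mg : measurable_fun setT
    (fun w => (\int[P]_w' (phi (Y (next_grid n (S t w)) w'))%:E)%E).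
  rewrite -[X in measurable_fun X]AU; apply/measurable_fun_bigcup => // k.
  apply: (@eq_measurable_fun _ _ _ _ _ (fun=> (\int[P]_w' (phi (Y (s k) w'))%:E)%E)).
    by move=> w /[!inE] Aw; rewrite (AE k w Aw).
  exact: measurable_cst.
have split_int (f : T -> \bar R) : measurable_fun setT f -> (forall w, (0 <= f w)%E) ->
    (\int[P]_w f w = \sum_(k <oo) \int[P]_(w in A k) f w)%E.
  by move=> mf' f0; rewrite -{1}AU ge0_integral_bigcup// AU.
rewrite split_int; first last.
- by move=> w; rewrite lee_fin.
- exact/measurable_EFinP.
rewrite split_int//; last first.
  by move=> w; apply: integral_ge0 => w' _; rewrite lee_fin.
apply: eq_eseriesr => k _.
transitivity (\int[P]_(w in A k) (phi (Y (s k) w))%:E)%E.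
  by apply: eq_integral => w /[!inE] Aw; rewrite (AE k w Aw).
transitivity (\int[P]_(w in A k) (cst (\int[P]_w' (phi (Y (s k) w'))%:E)) w)%E; last first.
  by apply: eq_integral => w /[!inE] Aw; rewrite (AE k w Aw).
rewrite integral_cst// muleC independent_integral//.
move=> B mB; apply: ind.
  apply: sub_gen_smallest; exists (s k); split; first by rewrite divr_ge0.
  by exists B.
apply: sub_gen_smallest; exists t; split => //.
by exists (grid_cell n k); split => //; exact: measurable_grid_cell.
Qed.


Lemma laplace_subordinated Y S Q (psi : R -> R) (t eta : R) :
  levy_process Y -> laplace_exponent Y psi ->
  {ae P, forall w, 0 <= S t w} -> independent_processes Y S ->
  {ae P, forall w, Q t w = Y (S t w) w} ->
  0 <= t -> 0 < eta -> 0 <= psi eta -> 0 <= psi (2 * eta) ->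
  P.-integrable setT (fun w => (expR (- (psi eta * S t w)))%:E) /\
  (\int[P]_w (expR (- (eta * Q t w)))%:E =
   \int[P]_w (expR (- (psi eta * S t w)))%:E)%E.
Proof.
move=> levyY lapY S0 ind QYS t0 eta0 psi0 psi20.
have grid0 n x : 0 <= next_grid n x by rewrite divr_ge0.
have mexp (a : R) : measurable_fun setT (fun x : R => expR (- (a * x))).
  apply: measurableT_comp => //; apply: measurableT_comp => //.
have lap a s : 0 < a -> 0 <= s ->
    (\int[P]_w (expR (- (a * Y s w)))%:E = (expR (- (psi a * s)))%:E)%E.
  by move=> a0 s0; have := lapY s a s0 a0; rewrite unlock mulrC.
have grid_int a n : 0 < a ->
    measurable_fun setT (fun w => expR (- (a * Y (next_grid n (S t w)) w))) /\
    (\int[P]_w (expR (- (a * Y (next_grid n (S t w)) w)))%:E =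
     \int[P]_w (expR (- (psi a * next_grid n (S t w))))%:E)%E.
  move=> a0; have [] := @integral_next_grid Y S t (fun x => expR (- (a * x))) n t0 ind
    (mexp a) (fun x => expR_ge0 _).
  move=> m1 ->; split => //; apply: eq_integral => w _.
  by rewrite lap.
have mS : measurable_fun setT (S t) by exact: measurable_funP.
have mQ : measurable_fun setT (Q t) by exact: measurable_funP.
have DCT := @dominated_convergence _ _ _ P setT measurableT
  (fun n w => (expR (- (psi eta * next_grid n (S t w))))%:E)
  (fun w => (expR (- (psi eta * S t w)))%:E) (cst 1%E).
have {DCT} [intS _ cvgS] : [/\ P.-integrable setT (fun w => (expR (- (psi eta * S t w)))%:E),
  [sequence (\int[P]_w `|(expR (- (psi eta * next_grid n (S t w))))%:E -
      (expR (- (psi eta * S t w)))%:E|)%E]_n @ \oo --> 0%E &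
  [sequence (\int[P]_w (expR (- (psi eta * next_grid n (S t w))))%:E)%E]_n @ \oo -->
   (\int[P]_w (expR (- (psi eta * S t w)))%:E)%E].
  apply: DCT.
  - move=> n; apply/measurable_EFinP; apply: (measurableT_comp (mexp _)).
    exact: (measurableT_comp (measurable_next_grid n)).
  - by apply/measurable_EFinP; apply: (measurableT_comp (mexp _)).
  - apply: filterS S0 => w Sw _.
    apply: cvg_EFin; first exact: nearW.
    apply: continuous_cvg; first exact: continuous_expR.
    by apply: cvgN; apply: cvgM; [exact: cvg_cst|exact: cvg_next_grid].
  - exact: finite_measure_integrable_cst.
  - apply: nearW => w n _ /=; rewrite ger0_norm ?expR_ge0// lee_fin.
    by rewrite -expR0 ler_expR oppr_le0 mulr_ge0.
split => //.
have Sfin := integrable_fin_num measurableT intS.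
rewrite -(fineK Sfin).
apply: (@cvg_integral_L2_bounded _ _ _ P
  (fun n w => expR (- (eta * Y (next_grid n (S t w)) w))) _ 1).
- by move=> n; have [] := grid_int eta n eta0.
- exact: (measurableT_comp (mexp eta)).
- by move=> n w; exact: expR_ge0.
- by move=> w; exact: expR_ge0.
- have [_ _ _ _ cadlag] := levyY.
  near=> w.
  have -> : Q t w = Y (S t w) w by near: w.
  have Sw : 0 <= S t w by near: w.
  have cad : forall r : R, 0 <= r -> Y u w @[u --> r^'+] --> Y r w /\
      (0 < r -> cvg (Y u w @[u --> r^'-])) by near: w; exact: cadlag.
  have [cw _] := cad _ Sw.
  apply: continuous_cvg; first exact: continuous_expR.
  apply: cvgN; apply: cvgM; first exact: cvg_cst.
  move/cvg_at_rightP : cw; apply; split; last exact: cvg_next_grid.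
  by move=> n; exact: next_grid_gt.
- move=> n.
  have -> : (\int[P]_w (expR (- (eta * Y (next_grid n (S t w)) w)) ^+ 2)%:E =
      \int[P]_w (expR (- ((2 * eta) * Y (next_grid n (S t w)) w)))%:E)%E.
    apply: eq_integral => w _; rewrite -expRM_natl; congr (expR _)%:E; ring.
  have e2 : 0 < 2 * eta by rewrite mulr_gt0.
  have [m2 ->] := grid_int _ n e2.
  have -> : (1%:E = \int[P]_w (cst 1%E) w)%E.
    rewrite integral_cst// -[LHS]mule1; congr (_ * _)%E; exact/esym/probability_setT.
  apply: ge0_le_integral => //.
  + apply/measurable_EFinP; apply: (measurableT_comp (mexp _)).
    exact: (measurableT_comp (measurable_next_grid n)).
  + by move=> w _; rewrite lee_fin -[X in _ <= X]expR0 ler_expR oppr_le0 mulr_ge0.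
- rewrite fineK//.
  apply: cvg_trans cvgS; apply: near_eq_cvg; apply: nearW => n.
  by have [_ ->] := grid_int eta n eta0.
Unshelve. all: by end_near. Qed.

End subordination.

(** * Tauberian theorem *)

Section cutoff.
Context (R : realType).
Implicit Types u v a b : R.

Lemma lipschitz_continuous (g : R -> R) (K : R) :
  (forall u v, `|g u - g v| <= K * `|u - v|) -> continuous g.
Proof.
move=> gK x; apply/cvgrPdist_lt => e e0.
have K0 : 0 < `|K| + 1 by rewrite ltr_wpDl.
near=> y; apply: le_lt_trans (gK _ _) _.
apply: (@le_lt_trans _ _ ((`|K| + 1) * `|x - y|)).
  by rewrite ler_wpM2r// ler_wpDr// ler_norm.
rewrite mulrC -ltr_pdivlMr//; near: y.
by apply: cvgr_dist_lt; [exact: cvg_id|rewrite divr_gt0].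
Unshelve. all: by end_near. Qed.

(* A continuous substitute for [v |-> 1_{v < b} / (1 - v)], interpolating
   between [a] and [b]. *)
Definition cutoff a b v : R :=
  Num.min 1 (Num.max 0 ((b - v) / (b - a))) / Num.max (1 - v) (1 - b).

(** A ramp with values between 0 and 1 times a reciprocal; truncating its denominator at [1 - b]
    keeps the pole at [v = 1] out. The constant adds the two terms of the product estimate. *)
Lemma cutoff_lipschitz a b : a < b -> b < 1 ->
  exists K : R, forall u v, `|cutoff a b u - cutoff a b v| <= K * `|u - v|.
Proof.
move=> ab b1.
pose tau v := Num.min 1 (Num.max 0 ((b - v) / (b - a))).
pose m v := Num.max (1 - v) (1 - b).
have ba : 0 < b - a by rewrite subr_gt0.
have c0 : 0 < 1 - b by rewrite subr_gt0.
have clamp (x y : R) : `|Num.min 1 (Num.max 0 x) - Num.min 1 (Num.max 0 y)| <= `|x - y|.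
  have E (z : R) : Num.min 1 (Num.max 0 z) = if z <= 0 then 0 else if 1 <= z then 1 else z.
    case: (leP z 0) => [z0|z0]; first by rewrite min_r.
    by case: (leP 1 z).
  have := ler_norm (x - y); have := ler_norm (y - x); rewrite (distrC y).
  rewrite ler_norml !E => h1 h2.
  by do 4?(case: ifPn; rewrite -?ltNge => ?); apply/andP; split; lra.
have tauL u v : `|tau u - tau v| <= (b - a)^-1 * `|u - v|.
  apply: le_trans (clamp _ _) _.
  rewrite -mulrBl normrM mulrC gtr0_norm ?invr_gt0// ler_wpM2l ?invr_ge0 ?(ltW ba)//.
  have -> : b - u - (b - v) = v - u by ring.
  by rewrite distrC.
have tau01 v : 0 <= tau v <= 1.
  by rewrite ge_min lexx/= le_min ler01 le_max lexx.
have mc v : 1 - b <= m v by rewrite le_max lexx orbT.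
have m0 v : 0 < m v by apply: lt_le_trans (mc v).
have mL u v : `|m v - m u| <= `|u - v|.
  have := ler_norm (u - v); have := ler_norm (v - u).
  rewrite /m (distrC v) ler_norml => ? ?.
  by case: (leP (1 - v) (1 - b)) => ?; case: (leP (1 - u) (1 - b)) => ?;
    apply/andP; split; lra.
have wL u v : `|(m u)^-1 - (m v)^-1| <= (1 - b) ^- 2 * `|u - v|.
  have -> : (m u)^-1 - (m v)^-1 = (m u)^-1 * (m v)^-1 * (m v - m u).
    by field; rewrite !gt_eqF.
  rewrite normrM; apply: ler_pM => //.
  rewrite gtr0_norm ?mulr_gt0 ?invr_gt0// -invfM lef_pV2 ?posrE ?mulr_gt0 ?exprn_gt0//.
  by rewrite expr2 ler_pM// ltW.
have w1 v : (m v)^-1 <= (1 - b)^-1 by rewrite lef_pV2 ?posrE.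
exists ((b - a)^-1 * (1 - b)^-1 + (1 - b) ^- 2) => u v.
rewrite /cutoff -/(tau u) -/(tau v) -/(m u) -/(m v).
have -> : tau u / m u - tau v / m v =
  (tau u - tau v) * (m u)^-1 + tau v * ((m u)^-1 - (m v)^-1) by ring.
apply: le_trans (ler_normD _ _) _; rewrite [leRHS]mulrDl; apply: lerD.
  rewrite normrM (mulrAC _ (1 - b)^-1); apply: ler_pM => //.
  by rewrite gtr0_norm ?invr_gt0.
have /andP[t0 t1] := tau01 v.
by rewrite normrM (ger0_norm t0) -[leRHS]mul1r; apply: ler_pM.
Qed.

(** For [v < b] the denominator is exactly [1 - v], so the weight cancels it and leaves the ramp;
    for [v >= b] the ramp is 0. *)
Lemma cutoffE a b v : a < b -> b < 1 ->
  [/\ 0 <= cutoff a b v * (1 - v), cutoff a b v * (1 - v) <= 1,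
   v <= a -> cutoff a b v * (1 - v) = 1 & b <= v -> cutoff a b v = 0].
Proof.
move=> ab b1; have ba : 0 < b - a by rewrite subr_gt0.
rewrite /cutoff; set tau := Num.min _ _.
have t0 : 0 <= tau by rewrite le_min ler01 le_max lexx.
have t1 : tau <= 1 by rewrite ge_min lexx.
have tb : b <= v -> tau = 0.
  move=> bv; rewrite /tau; have -> : Num.max 0 ((b - v) / (b - a)) = 0.
    by apply: max_l; rewrite pmulr_lle0 ?invr_gt0// subr_le0.
  exact: min_r.
have ta : v <= a -> tau = 1.
  move=> va; apply: min_l; rewrite le_max ler_pdivlMr// mul1r lerD2l lerN2 va.
  exact: orbT.
have mE : v < b -> tau / Num.max (1 - v) (1 - b) * (1 - v) = tau.
  move=> vb; have -> : Num.max (1 - v) (1 - b) = 1 - v.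
    by apply: max_l; rewrite lerD2l lerN2 ltW.
  by rewrite divfK// gt_eqF// subr_gt0 (lt_trans vb).
split.
- case: (ltP v b) => [/mE ->//|/tb ->]; by rewrite !mul0r.
- by case: (ltP v b) => [/mE ->//|/tb ->]; rewrite !mul0r ler01.
- by move=> va; rewrite mE ?ta// (le_lt_trans va).
- by move=> /tb ->; rewrite mul0r.
Qed.

End cutoff.

Section tauberian.
Context d (T : measurableType d) (R : realType) (P : probability T R).
Variables (X : {RV P >-> R}) (beta L : R).
Hypotheses (beta0 : 0 < beta) (beta1 : beta < 1) (L0 : 0 <= L).
Notation mu := (@lebesgue_measure R).
Implicit Types eta : R.

Lemma cvg_scale_at_right0 (c : R) : 0 < c -> (c * eta) @[eta --> 0^'+] --> 0^'+.
Proof.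
move=> c0 A [e /= e0 eA]; exists (e / c); first by rewrite /= divr_gt0.
move=> x /=; rewrite sub0r normrN => xe x0; apply: eA => /=; last exact: mulr_gt0.
by rewrite sub0r normrN normrM (gtr0_norm c0) mulrC -ltr_pdivlMr.
Qed.

Let V eta w := expR (- (eta * Num.max (X w) 0)).

Let mX : measurable_fun setT X.
Proof. exact: measurable_funP. Qed.

Let mV eta : measurable_fun setT (V eta).
Proof.
apply: measurableT_comp => //; apply: measurableT_comp => //.
apply: measurable_funM; first exact: measurable_cst.
by apply: measurable_maxr => //; exact: measurable_cst.
Qed.

Let mE eta : measurable_fun setT (fun w => expR (- (eta * X w))).
Proof.
apply: measurableT_comp => //; apply: measurableT_comp => //.
by apply: measurable_funM => //; exact: measurable_cst.
Qed.

Let V01 eta w : 0 <= eta -> 0 <= V eta w <= 1.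
Proof.
move=> eta0; rewrite expR_ge0/= -[leRHS]expR0 ler_expR oppr_le0 mulr_ge0//.
by rewrite le_max lexx orbT.
Qed.

Let bounded_integrable (f : T -> R) (K : R) : measurable_fun setT f ->
  (forall w, `|f w| <= K) -> P.-integrable setT (EFin \o f).
Proof.
move=> mf fK; apply: (@le_integrable _ _ _ P setT measurableT _ (cst K%:E)).
- exact/measurable_EFinP.
- by move=> w _ /=; rewrite lee_fin (le_trans (fK w))// ler_norm.
- exact: finite_measure_integrable_cst.
Qed.

Let iV eta : 0 <= eta -> P.-integrable setT (EFin \o V eta).
Proof.
move=> eta0; apply: (@bounded_integrable _ 1) => // w.
by have /andP[? ?] := V01 w eta0; rewrite ger0_norm.
Qed.

Lemma cvg_laplace_positive_part (eta0 : R) : 0 < eta0 ->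
  P.-integrable setT (fun w => (expR (- (eta0 * X w)))%:E) ->
  (1 - \int[P]_w expR (- (eta * X w)))%R / eta `^ beta @[eta --> 0^'+] --> L ->
  (1 - \int[P]_w V eta w)%R / eta `^ beta @[eta --> 0^'+] --> L.
Proof.
move=> e0 i0 XL.
pose K := (2 / eta0 * \int[P]_w expR (- (eta0 * X w)))%R.
(* For [x = - y < 0] one starts from [exp (eta y) - 1 <= eta y exp (eta y)]. Half of the exponent
   [eta0 y] absorbs the factor [y], the other half dominates [exp (eta y)]; hence
   [eta <= eta0 / 2]. *)
have bnd (eta x : R) : 0 < eta -> eta <= eta0 / 2 ->
    0 <= expR (- (eta * x)) - expR (- (eta * Num.max x 0)) <=
    eta * (2 / eta0) * expR (- (eta0 * x)).
  move=> eta_gt0 ee; case: (leP 0 x) => x0.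
    by rewrite subrr lexx/= !mulr_ge0 ?expR_ge0 ?invr_ge0 ?ltW.
  rewrite mulr0 oppr0 expR0; apply/andP; split.
    rewrite subr_ge0 -[leLHS]expR0 ler_expR oppr_ge0 mulr_ge0_le0 ?ltW//.
  pose y := - x; have y0 : 0 < y by rewrite oppr_gt0.
  rewrite -!mulrN -/y.
  have h1 : expR (eta * y) - 1 <= eta * y * expR (eta * y).
    have := expR_ge1Dx (- (eta * y)); rewrite expRN => h.
    have := expR_gt0 (eta * y); set z := expR _ in h * => z0.
    have := ler_wpM2r (ltW z0) h; rewrite mulVf ?gt_eqF// mulrDl; lra.
  have h2 : y <= 2 / eta0 * expR (eta0 / 2 * y).
    have := expR_ge1Dx (eta0 / 2 * y) => h.
    rewrite -ler_pdivrMl ?divr_gt0// invf_div.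
    by apply: le_trans h; rewrite lerDr.
  have h3 : expR (eta * y) <= expR (eta0 / 2 * y) by rewrite ler_expR ler_pM2r.
  apply: le_trans h1 _.
  have -> : expR (eta0 * y) = expR (eta0 / 2 * y) * expR (eta0 / 2 * y).
    by rewrite -expRD; congr expR; field.
  rewrite -!mulrA ler_pM2l// [leRHS]mulrA [leRHS]mulrA.
  by apply: ler_pM; rewrite ?(ltW y0) ?expR_ge0 ?[eta0 * (2^-1 * y)]mulrA.
have iE eta : 0 < eta -> eta <= eta0 / 2 ->
    P.-integrable setT (fun w => (expR (- (eta * X w)))%:E).
  move=> eta_gt0 ee.
  have i2 : P.-integrable setT (fun w => (eta * (2 / eta0) * expR (- (eta0 * X w)))%:E).
    rewrite (_ : (fun _ => _) = fun w => ((eta * (2 / eta0))%:E * (expR (- (eta0 * X w)))%:E)%E)//.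
    exact: integrableZl.
  apply: (le_integrable measurableT _ _ (integrableD measurableT (iV (ltW eta_gt0)) i2)).
  - exact/measurable_EFinP.
  - move=> w _ /=; rewrite lee_fin.
    rewrite [leRHS]ger0_norm ?ger0_norm ?expR_ge0//.
    + by have /andP[_] := bnd eta (X w) eta_gt0 ee; rewrite /V; lra.
    + by rewrite addr_ge0 ?expR_ge0// !mulr_ge0 ?expR_ge0 ?invr_ge0 ?ltW.
have diff eta : 0 < eta -> eta <= eta0 / 2 ->
    0 <= (\int[P]_w expR (- (eta * X w)) - \int[P]_w V eta w)%R <= K * eta.
  move=> eta_gt0 ee.
  rewrite -RintegralB//; [|exact: iE|exact: (iV (ltW eta_gt0))].
  apply/andP; split.
    by apply: Rintegral_ge0 => w _; have /andP[] := bnd eta (X w) eta_gt0 ee.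
  have -> : K * eta = (\int[P]_w (eta * (2 / eta0) * expR (- (eta0 * X w))))%R.
    by rewrite RintegralZl// /K; ring.
  apply: le_Rintegral => //.
  - have := integrableB measurableT (iE _ eta_gt0 ee) (iV (ltW eta_gt0)).
    by apply: eq_integrable.
  - rewrite (_ : _ \o _ = fun w => ((eta * (2 / eta0))%:E * (expR (- (eta0 * X w)))%:E)%E)//.
    exact: integrableZl.
  - by move=> w _; have /andP[] := bnd eta (X w) eta_gt0 ee.
have K0 : 0 <= K.
  by rewrite mulr_ge0 ?divr_ge0 ?Rintegral_ge0 ?ltW// => w _; rewrite expR_ge0.
rewrite -[X in _ --> X]addr0.
rewrite (_ : (fun eta => _) = (fun eta : R =>
  (1 - \int[P]_w expR (- (eta * X w)))%R / eta `^ beta +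
  (\int[P]_w expR (- (eta * X w)) - \int[P]_w V eta w)%R / eta `^ beta)); last first.
  by apply/funext => eta; ring.
apply: cvgD => //.
apply: (@squeeze_cvgr _ _ _ _ (fun=> 0) (fun eta => K * eta `^ (1 - beta))).
- near=> eta.
  have eta_gt0 : 0 < eta by near: eta; exact: nbhs_right_gt.
  have ee : eta <= eta0 / 2 by near: eta; apply: nbhs_right_le; rewrite divr_gt0.
  have /andP[h1 h2] := diff _ eta_gt0 ee.
  rewrite divr_ge0 ?powR_ge0//= ler_pdivrMr ?powR_gt0// -mulrA -powRD.
    by rewrite subrK powRr1// ltW.
  by rewrite (gt_eqF eta_gt0) implybT.
- exact: cvg_cst.
- rewrite -[X in _ --> X](mulr0 K); apply: cvgM; first exact: cvg_cst.
  have b1 : 0 < 1 - beta by rewrite subr_gt0.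
  exact: (powR_cvg0 b1).
Unshelve. all: by end_near. Qed.


(** * The limiting measure and the convergence of moments *)

Let Gam := Gamma (1 - beta).
Let Gam0 : 0 < Gam := Gamma_onem_gt0 beta0 beta1.

Let nu (x : R) : R := beta * x `^ (- beta - 1).

Let moment (k : nat) :
  mu.-integrable `]0, +oo[ (EFin \o (fun x : R => (1 - expR (- (k%:R * x))) * nu x)) /\
  (\int[mu]_(x in `]0%R, +oo[) ((1 - expR (- (k%:R * x))) * nu x))%R
    = k%:R `^ beta * Gam.
Proof.
case: k => [|k]; last exact: Rintegral_onem_expR_powR.
have E : (fun x => (1 - expR (- (0%:R * x))) * nu x) = fun=> 0.
  by apply/funext => x; rewrite mul0r oppr0 expR0 subrr mul0r.
rewrite E powR0 ?gt_eqF// mul0r; split; first exact: integrable0.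
by rewrite /Rintegral integral0.
Qed.

Let W (x : R) := L / Gam * ((1 - expR (- x)) * nu x).

Let limit_functional (g : R -> R) : R :=
  (\int[mu]_(x in `]0%R, +oo[) (g (expR (- x)) * W x))%R.

Let iW : mu.-integrable `]0, +oo[ (EFin \o W).
Proof.
rewrite (_ : _ \o _ = (fun x => (L / Gam)%:E *
  (EFin \o (fun y : R => (1 - expR (- (1%:R * y))) * nu y)%R) x)%E).
  by apply: integrableZl => //; have [] := moment 1.
by apply/funext => x /=; rewrite /W mul1r EFinM.
Qed.

Let W_ge0 x : 0 < x -> 0 <= W x.
Proof.
move=> x0; rewrite mulr_ge0 ?divr_ge0 ?(ltW Gam0)// mulr_ge0//.
  by rewrite subr_ge0 -expR0 ler_expR oppr_le0 ltW.
by rewrite mulr_ge0 ?powR_ge0 ?ltW.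
Qed.

Let limit_positive : positive_functional limit_functional.
Proof.
apply: weighted_integral_positive => //.
- by apply: measurable_funTS; apply: measurableT_comp.
- move=> x /=; rewrite in_itv/= andbT => x0.
  by rewrite expR_ge0/= -[leRHS]expR0 ler_expR oppr_le0 ltW.
- by move=> x /=; rewrite in_itv/= andbT; exact: W_ge0.
Qed.

(** [exp (- k x) (1 - exp (- x))] is the difference of [1 - exp (- (k + 1) x)] and
    [1 - exp (- k x)], so two instances of [moment] are subtracted and [Gam] cancels. *)
Let limit_monomial (k : nat) : limit_functional (fun v => v ^+ k) =
  L * (k.+1%:R `^ beta - k%:R `^ beta).
Proof.
have [i1 E1] := moment k.+1; have [i2 E2] := moment k.
have -> : L * (k.+1%:R `^ beta - k%:R `^ beta) =
   L / Gam * (k.+1%:R `^ beta * Gam - k%:R `^ beta * Gam).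
  by field; rewrite gt_eqF.
rewrite -E1 -E2 -RintegralB// -RintegralZl//; last first.
  have iB : mu.-integrable `]0, +oo[ ((EFin \o (fun x : R => (1 - expR (- (k.+1%:R * x))) * nu x)%R)
     \- (EFin \o (fun x : R => (1 - expR (- (k%:R * x))) * nu x)%R))%E.
    exact: integrableB.
  by move: iB; apply: eq_integrable.
apply: eq_Rintegral => x _; rewrite /W -expRM_natl -natr1.
have -> : k%:R * - x = - (k%:R * x) by ring.
have -> : - ((k%:R + 1) * x) = - (k%:R * x) + - x by ring.
by rewrite expRD; ring.
Qed.

Let Lam eta (g : R -> R) : R :=
  (\int[P]_w (g (V eta w) * ((1 - V eta w) / eta `^ beta)))%R.

Let iwt eta : 0 < eta ->
  P.-integrable setT (EFin \o (fun w => (1 - V eta w) / eta `^ beta)).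
Proof.
move=> eta0; apply: (@bounded_integrable _ (eta `^ beta)^-1).
  apply: measurable_funM; last exact: measurable_cst.
  by apply: measurable_funB => //; exact: measurable_cst.
move=> w; have /andP[h0 h1] := V01 w (ltW eta0).
rewrite normrM (ger0_norm (_ : 0 <= (eta `^ beta)^-1)) ?invr_ge0 ?powR_ge0//.
by rewrite ler_piMl ?invr_ge0 ?powR_ge0// ger0_norm ?subr_ge0// gerBl.
Qed.

Let Lam_positive eta : 0 < eta -> positive_functional (Lam eta).
Proof.
move=> eta0; apply: weighted_integral_positive => //.
- by move=> w _; apply: V01; exact: ltW.
- exact: iwt.
- move=> w _; have /andP[h0 h1] := V01 w (ltW eta0).
  by rewrite divr_ge0 ?powR_ge0// subr_ge0.
Qed.

Hypothesis VL : (1 - \int[P]_w V eta w)%R / eta `^ beta @[eta --> 0^'+] --> L.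

Let Lam_monomial (k : nat) : Lam eta (fun v => v ^+ k) @[eta --> 0^'+] -->
  limit_functional (fun v => v ^+ k).
Proof.
rewrite limit_monomial.
have VM (j : nat) eta w : V eta w ^+ j = V (j%:R * eta) w.
  by rewrite /V -expRM_natl; congr expR; ring.
(* Rescaling [eta] by [j] produces the factor [j^beta]. The case [j = 0] is not a rescaling of [VL],
   but there [V] is constantly 1. *)
have scaled (j : nat) : (1 - \int[P]_w V (j%:R * eta) w)%R / eta `^ beta
    @[eta --> 0^'+] --> L * j%:R `^ beta.
  case: j => [|j].
    rewrite powR0 ?gt_eqF// mulr0.
    rewrite (_ : (fun _ => _) = fun=> 0); first exact: cvg_cst.
    apply/funext => eta.
    have -> : (\int[P]_w V (0%:R * eta) w)%R = 1.
      rewrite (_ : (fun w => _) = cst 1).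
        rewrite Rintegral_cst// mul1r.
        by rewrite (_ : fine _ = fine (1%E : \bar R)) //; congr fine; exact: probability_setT.
      by apply/funext => w; rewrite /V !mul0r oppr0 expR0.
    by rewrite subrr mul0r.
  have j0 : 0 < j.+1%:R :> R by [].
  have := cvg_comp _ _ (cvg_scale_at_right0 j0) VL => h.
  apply: cvg_trans (cvgM h (cvg_cst (j.+1%:R `^ beta))).
  apply: near_eq_cvg; near=> eta.
  have eta0 : 0 < eta by near: eta; exact: nbhs_right_gt.
  rewrite /= powRM ?(ltW eta0)//.
  by field; rewrite !gt_eqF ?powR_gt0.
rewrite mulrBr; apply: cvg_trans (cvgB (scaled k.+1) (scaled k)).
apply: near_eq_cvg; near=> eta.
have eta0 : 0 < eta by near: eta; exact: nbhs_right_gt.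
rewrite /Lam.
have -> : (fun w => V eta w ^+ k * ((1 - V eta w) / eta `^ beta)) =
  fun w => (V (k%:R * eta) w - V (k.+1%:R * eta) w) * (eta `^ beta)^-1.
  by apply/funext => w; rewrite -!VM exprSr; ring.
have k0 (j : nat) : 0 <= j%:R * eta by rewrite mulr_ge0 ?(ltW eta0).
rewrite RintegralZr//; last first.
  by have := integrableB measurableT (iV (k0 k)) (iV (k0 k.+1)); apply: eq_integrable.
rewrite RintegralB//; [|exact: (iV (k0 k))|exact: (iV (k0 k.+1))].
transitivity ((1 - \int[P]_w V (k.+1%:R * eta) w) / eta `^ beta -
  (1 - \int[P]_w V (k%:R * eta) w) / eta `^ beta)%R; first by [].
ring.
Unshelve. all: by end_near. Qed.


(** * From test functions back to the tail *)

Let C := L / Gam.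

Let C0 : 0 <= C.
Proof. by rewrite divr_ge0// ltW. Qed.

Let tail (x : R) : R := fine (P [set w | x < X w]).

(** In the variable [x = - ln v] this is 0 for [x <= p] and [1 / (1 - exp (- x))] for [x >= q]. With
    [v = V eta w] the thresholds become the levels [p / eta] and [q / eta] of [X]. *)
Let cut (p q : R) := cutoff (expR (- q)) (expR (- p)).

Let cut_lt (p q : R) : 0 < p -> p < q ->
  expR (- q) < expR (- p) /\ expR (- p) < 1.
Proof. by move=> p0 pq; rewrite ltr_expR ltrN2 pq -[ltRHS]expR0 ltr_expR oppr_lt0. Qed.

Let cut_continuous (p q : R) : 0 < p -> p < q -> continuous (cut p q).
Proof.
move=> p0 pq; have [ab b1] := cut_lt p0 pq.
have [K HK] := cutoff_lipschitz ab b1.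
exact: lipschitz_continuous HK.
Qed.

Let Lam_cut (p q : R) : 0 < p -> p < q ->
  Lam eta (cut p q) @[eta --> 0^'+] --> limit_functional (cut p q).
Proof.
move=> p0 pq; have [ab b1] := cut_lt p0 pq.
have [K HK] := cutoff_lipschitz ab b1.
apply: (cvg_functional_lipschitz _ limit_positive Lam_monomial (cut_continuous p0 pq)).
- near=> eta; apply: Lam_positive; near: eta; exact: nbhs_right_gt.
- by move=> x y _ _; exact: HK.
Unshelve. all: by end_near. Qed.

(** Once weighted, the cut lies between the indicators of [x >= q] and [x >= p], and [nu] has mass
    [r^(-beta)] beyond [r]. *)
Let limit_cut (p q : R) : 0 < p -> p < q ->
  C * q `^ (- beta) <= limit_functional (cut p q) <= C * p `^ (- beta).
Proof.
move=> p0 pq; have [ab b1] := cut_lt p0 pq.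
have q0 : 0 < q by exact: lt_trans pq.
pose h (x : R) := cut p q (expR (- x)) * W x.
have hE x : h x = C * (cut p q (expR (- x)) * (1 - expR (- x)) * nu x).
  by rewrite /h /W -/C; ring.
have nu0 x : 0 <= nu x by rewrite mulr_ge0 ?powR_ge0 ?ltW.
have h0 x : 0 <= h x.
  by rewrite hE mulr_ge0// mulr_ge0//; have [] := cutoffE (expR (- x)) ab b1.
have hnu x : h x <= C * nu x.
  rewrite hE ler_wpM2l// ler_piMl//; have [] := cutoffE (expR (- x)) ab b1 => //.
have hq x : q <= x -> h x = C * nu x.
  move=> qx; rewrite hE; have vq : expR (- x) <= expR (- q) by rewrite ler_expR lerN2.
  by have [_ _ /(_ vq) -> _] := cutoffE (expR (- x)) ab b1; rewrite mul1r.
have hp x : x <= p -> h x = 0.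
  move=> xp; rewrite hE; have vp : expR (- p) <= expR (- x) by rewrite ler_expR lerN2.
  have [_ _ _ /(_ vp) E] := cutoffE (expR (- x)) ab b1.
  by rewrite /cut E !mul0r mulr0.
have mnu (D : set R) : measurable D -> D `<=` `]0, +oo[%classic ->
    measurable_fun D (EFin \o nu).
  move=> mD sub; apply/measurable_EFinP; apply: continuous_gt0_measurable => // x x0.
  by apply: cvgM; [exact: cvg_cst|exact: continuous_powR].
have mh (D : set R) : measurable D -> D `<=` `]0, +oo[%classic ->
    measurable_fun D (EFin \o h).
  move=> mD sub; apply/measurable_EFinP; apply: continuous_gt0_measurable => // x x0.
  have cN : {for x, continuous (fun y : R => expR (- y))}.
    by apply: continuous_comp; [exact: opp_continuous|exact: continuous_expR].
  apply: cvgM.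
    apply: (@continuous_comp _ _ _ (fun y : R => expR (- y)) (cut p q)) => //.
    exact: cut_continuous.
  apply: cvgM; first exact: cvg_cst.
  apply: cvgM; first by apply: cvgB; [exact: cvg_cst|exact: cN].
  by apply: cvgM; [exact: cvg_cst|exact: continuous_powR].
have sub (r : R) : 0 < r -> `[r, +oo[%classic `<=` (`]0, +oo[%classic : set R).
  by move=> r0 x /=; rewrite !in_itv/= !andbT; exact: lt_le_trans.
have Cnu (r : R) : 0 < r ->
    (\int[mu]_(x in `[r, +oo[) (C%:E * (nu x)%:E) = (C * r `^ (- beta))%:E)%E.
  move=> r0; rewrite ge0_integralZl_EFin//.
  - by rewrite integral_powR_cy// EFinM.
  - by move=> x _; rewrite lee_fin.
  - by apply: mnu => //; exact: sub.
have up : (\int[mu]_(x in `]0%R, +oo[) (h x)%:E <= (C * p `^ (- beta))%:E)%E.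
  have -> : `]0, +oo[%classic = `]0, p[%classic `|` `[p, +oo[%classic :> set R.
    apply/seteqP; split => x /=; rewrite !in_itv/= !andbT.
      by move=> x0; case: (ltP x p) => [xp|]; [left; rewrite x0|right].
    by move=> [/andP[]//|]; apply: lt_le_trans.
  have subU : `]0, p[%classic `|` `[p, +oo[%classic `<=` (`]0, +oo[%classic : set R).
    move=> x /= []; rewrite !in_itv/= !andbT; first by move=> /andP[].
    exact: lt_le_trans.
  rewrite ge0_integral_setU//=; last 3 first.
  - by apply: mh => //; exact: measurableU.
  - by move=> x _; rewrite lee_fin.
  - apply/disj_setPRL => x /=; rewrite !in_itv/= andbT => x1 /andP[_].
    by rewrite ltNge x1.
  rewrite integral0_eq ?add0e; last first.
    by move=> x /=; rewrite in_itv/= => /andP[_ /ltW/hp ->].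
  rewrite -(Cnu p p0); apply: ge0_le_integral => //.
  - by move=> x _; rewrite lee_fin.
  - by apply: mh => //; exact: sub.
  - apply: emeasurable_funM; first exact: measurable_cst.
    by apply: mnu => //; exact: sub.
  - by move=> x _; rewrite -EFinM lee_fin.
have low : ((C * q `^ (- beta))%:E <= \int[mu]_(x in `]0%R, +oo[) (h x)%:E)%E.
  apply: (@le_trans _ _ (\int[mu]_(x in `[q, +oo[) (h x)%:E)%E).
    rewrite -(Cnu q q0) le_eqVlt; apply/orP; left; apply/eqP.
    apply: eq_integral => x /[!inE] /=; rewrite in_itv/= andbT => qx.
    by rewrite hq// EFinM.
  apply: ge0_subset_integral => //.
  - exact: mh.
  - by move=> x _; rewrite lee_fin.
  - exact: sub.
have hfin : (\int[mu]_(x in `]0%R, +oo[) (h x)%:E \is a fin_num)%E.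
  rewrite ge0_fin_numE; first exact: le_lt_trans up (ltry _).
  by apply: integral_ge0 => x _; rewrite lee_fin.
by rewrite /limit_functional /Rintegral -!lee_fin fineK// up low.
Qed.

Let tail_cut (p q eta : R) : 0 < p -> p < q -> 0 < eta ->
  tail (q / eta) / eta `^ beta <= Lam eta (cut p q) <= tail (p / eta) / eta `^ beta.
Proof.
move=> p0 pq eta0; have [ab b1] := cut_lt p0 pq.
have q0 : 0 < q by exact: lt_trans pq.
have mgt (r : R) : measurable [set w | r < X w].
  rewrite [X in measurable X](_ : _ = X @^-1` `]r, +oo[%classic).
    by rewrite -[X in measurable X]setTI; apply: mX.
  by apply/seteqP; split => w /=; rewrite in_itv/= andbT.
have eb0 : 0 <= (eta `^ beta)^-1 by rewrite invr_ge0 powR_ge0.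
have tailE (r : R) : tail r / eta `^ beta =
    (\int[P]_w (\1_[set w | (r < X w)%R] w * (eta `^ beta)^-1))%R.
  rewrite RintegralZr//; last first.
    by apply: (@bounded_integrable _ 1) => // w; rewrite indicE; case: (_ \in _); rewrite ?normr1 ?normr0.
  congr (_ * _); rewrite /tail /Rintegral integral_indic// setIT//.
have i1 (r : R) : P.-integrable setT (EFin \o (fun w => \1_[set w | (r < X w)%R] w * (eta `^ beta)^-1)).
  apply: (@bounded_integrable _ (eta `^ beta)^-1).
    by apply: measurable_funM => //; exact: measurable_cst.
  move=> w; rewrite indicE; case: (_ \in _); rewrite ?mul1r ?mul0r ?normr0//.
  by rewrite ger0_norm.
(* At a positive level the positive part is invisible, so both indicators around the cut become
   events about [X]. *)
have VE w (r : R) : 0 < r -> (V eta w < expR (- r)) = (r / eta < X w).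
  move=> r0; rewrite ltr_expR ltrN2 maxr_pMr ?(ltW eta0)// mulr0 lt_max.
  by rewrite [r < 0]ltNge (ltW r0) orbF ltr_pdivrMr// mulrC.
have mcut : measurable_fun setT (fun w => cut p q (V eta w)).
  apply: (measurableT_comp _ (mV eta)).
  by apply: continuous_measurable_fun; exact: cut_continuous.
have i2 : P.-integrable setT
    (EFin \o (fun w => cut p q (V eta w) * ((1 - V eta w) / eta `^ beta))).
  apply: (@bounded_integrable _ (eta `^ beta)^-1).
    apply: measurable_funM => //; apply: measurable_funM; last exact: measurable_cst.
    by apply: measurable_funB => //; exact: measurable_cst.
  move=> w; have [h1 h2 _ _] := cutoffE (V eta w) ab b1.
  by rewrite mulrA (ger0_norm (mulr_ge0 h1 eb0)); exact: ler_piMl.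
have memE w (r : R) : (w \in [set w | r < X w]) = (r < X w).
  by apply/idP/idP; rewrite inE.
rewrite !tailE; apply/andP; split; apply: le_Rintegral => // w _;
    have [h1 h2 h3 h4] := cutoffE (V eta w) ab b1;
    rewrite mulrA; apply: ler_wpM2r => //; rewrite indicE memE -VE//.
- by case: (ltP (V eta w) (expR (- q))) => [/ltW/h3 ->|_].
- case: (ltP (V eta w) (expR (- p))) => [_|/h4 E]; first exact: h2.
  by rewrite /cut E mul0r.
Qed.

(** The cuts between 1 and [q] and between [p] and 1 enclose the tail at [1 / eta]. Continuity of
    [r^(-beta)] at 1 brings their limit bounds within [e / 2] of [C]. *)
Let cvg_tail0 : tail (1 / eta) / eta `^ beta @[eta --> 0^'+] --> C.
Proof.
have cC : C * r `^ (- beta) @[r --> (1 : R)] --> C.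
  have E1 : (1 : R) `^ (- beta) = 1 by rewrite powR1.
  rewrite -[X in _ --> X]mulr1 -[X in _ --> C * X]E1.
  by apply: cvgM; [exact: cvg_cst|exact: continuous_powR].
apply/cvgrPdist_le => e e0.
have e2 : 0 < e / 2 by rewrite divr_gt0.
have [r /= r0 hr] : \forall r \near (1 : R), `|C - C * r `^ (- beta)| <= e / 2.
  by move/cvgrPdist_le : cC; exact.
(* [r / 2] stays inside the neighbourhood of continuity; [1 / 2] keeps [p] positive. *)
pose del := Num.min (r / 2) (1 / 2).
have del0 : 0 < del by rewrite lt_min !divr_gt0.
have del1 : del < 1 by rewrite gt_min; apply/orP; right; lra.
have delr : del < r by rewrite gt_min; apply/orP; left; lra.
pose p := 1 - del; pose q := 1 + del.
have p0 : 0 < p by rewrite subr_gt0.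
have p1 : p < 1 by rewrite gtrBl.
have q1 : 1 < q by rewrite ltrDl.
have hp : `|C - C * p `^ (- beta)| <= e / 2.
  by apply: hr; rewrite /= /p opprB addrC subrK gtr0_norm.
have hq : `|C - C * q `^ (- beta)| <= e / 2.
  by apply: hr; rewrite /= /q opprD addNKr normrN gtr0_norm.
have /andP[_ up] := limit_cut p0 p1.
have /andP[low _] := limit_cut ltr01 q1.
near=> eta.
have eta0 : 0 < eta by near: eta; exact: nbhs_right_gt.
have h1 : `|limit_functional (cut p 1) - Lam eta (cut p 1)| <= e / 2.
  by near: eta; move/cvgrPdist_le : (Lam_cut p0 p1); exact.
have h2 : `|limit_functional (cut 1 q) - Lam eta (cut 1 q)| <= e / 2.
  by near: eta; move/cvgrPdist_le : (Lam_cut ltr01 q1); exact.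
have /andP[t1 _] := tail_cut p0 p1 eta0.
have /andP[_ t2] := tail_cut ltr01 q1 eta0.
move: hp hq h1 h2; rewrite !ler_norml => /andP[? ?] /andP[? ?] /andP[? ?] /andP[? ?].
apply/andP; split; lra.
Unshelve. all: by end_near. Qed.

Lemma cvg_tail : x `^ beta * fine (P [set w | x < X w]) @[x --> +oo] --> L / Gamma (1 - beta).
Proof.
have inv0 : (x^-1 : R) @[x --> +oo] --> 0^'+.
  move=> A [e /= e0 eA]; suff h : \forall x \near +oo, A (x^-1 : R) by exact: h.
  near=> x.
  have x0 : 0 < x by near: x; exact: nbhs_pinfty_gt.
  apply: eA => /=; last by rewrite invr_gt0.
  rewrite sub0r normrN gtr0_norm ?invr_gt0// invf_plt ?posrE//.
  by near: x; apply: nbhs_pinfty_gt; exact: num_real.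
apply: cvg_trans (cvg_comp _ _ inv0 cvg_tail0); apply: near_eq_cvg; near=> x.
have x0 : 0 < x by near: x; exact: nbhs_pinfty_gt.
rewrite /= div1r invrK mulrC; congr (_ * _).
have -> : x^-1 = x `^ (- 1) by rewrite powR_inv1 ?ltW.
by rewrite -powRrM mulN1r powRN invrK.
Unshelve. all: by end_near. Qed.

End tauberian.

Lemma laplace_tauberian d (T : measurableType d) (R : realType)
    (P : probability T R) (X : {RV P >-> R}) (beta L eta0 : R) :
  0 < beta < 1 -> 0 <= L -> 0 < eta0 ->
  P.-integrable setT (fun w => (expR (- (eta0 * X w)))%:E) ->
  (1 - \int[P]_w expR (- (eta * X w)))%R / eta `^ beta @[eta --> 0^'+] --> L ->
  x `^ beta * fine (P [set w | x < X w]) @[x --> +oo] --> L / Gamma (1 - beta).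
Proof.
move=> /andP[b0 b1] L0 e0 i0 XL; apply: cvg_tail => //.
exact: cvg_laplace_positive_part i0 XL.
Qed.

(* The variance of [exp (- eta X)] vanishes. *)
Lemma laplace_eq1_ae0 d (T : measurableType d) (R : realType)
    (P : probability T R) (X : {RV P >-> R}) (eta : R) : 0 < eta ->
  (\int[P]_w (expR (- (eta * X w)))%:E = 1)%E ->
  (\int[P]_w (expR (- (2 * eta * X w)))%:E = 1)%E ->
  {ae P, forall w, X w = 0}.
Proof.
move=> eta0 E1 E2.
have mX : measurable_fun setT X by exact: measurable_funP.
have mexp (a : R) : measurable_fun setT (fun w => expR (- (a * X w))).
  apply: measurableT_comp => //; apply: measurableT_comp => //.
  by apply: measurable_funM => //; exact: measurable_cst.
have iexp (a : R) : (\int[P]_w (expR (- (a * X w)))%:E = 1)%E ->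
    P.-integrable setT (fun w => (expR (- (a * X w)))%:E).
  move=> Ea; apply/integrableP; split; first exact/measurable_EFinP.
  under eq_integral do rewrite gee0_abs ?lee_fin ?expR_ge0//.
  by rewrite Ea ltry.
pose f w := (expR (- (eta * X w)) - 1) ^+ 2.
have If : (\int[P]_w (f w)%:E = 0)%E.
  have -> : (\int[P]_w (f w)%:E = \int[P]_w ((expR (- (2 * eta * X w)))%:E -
      (2%:E * (expR (- (eta * X w)))%:E - (cst 1%E) w)))%E.
    apply: eq_integral => w _; rewrite /= -EFinD; congr EFin.
    rewrite /f (_ : - (2 * eta * X w) = - (eta * X w) + - (eta * X w)); last by ring.
    by rewrite expRD; ring.
  have i2 : P.-integrable setT (fun w => (2%:E * (expR (- (eta * X w)))%:E)%E).
    by apply: integrableZl => //; exact: iexp.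
  have i3 : P.-integrable setT (fun w : T => (cst 1%E) w : \bar R).
    exact: finite_measure_integrable_cst.
  rewrite integralB//; [|exact: iexp|exact: integrableB].
  rewrite integralB// integralZl//; last exact: iexp.
  rewrite E1 E2 integral_cst//.
  have -> : (1 * P [set: T] = 1)%E by rewrite mul1e; exact: probability_setT.
  by rewrite mule1 -!EFinB; congr EFin; ring.
have mf : measurable_fun setT (EFin \o f).
  by apply/measurable_EFinP; apply: measurable_funX; apply: measurable_funB.
have : ae_eq P setT (EFin \o f) (cst 0%E).
  apply/ae_eq_integral_abs => //.
  under eq_integral do rewrite /= ger0_norm ?sqr_ge0//.
  exact: If.
apply: filterS => w /(_ I) /= [] /eqP; rewrite sqrf_eq0 subr_eq0 => /eqP.
rewrite -expR0 => /expR_inj /eqP; rewrite oppr_eq0 mulf_eq0 gt_eqF//= => /eqP.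
by [].
Qed.

Lemma tail_ae0 d (T : measurableType d) (R : realType)
    (P : probability T R) (X : {RV P >-> R}) :
  {ae P, forall w, X w = 0} ->
  \forall x \near +oo, fine (P [set w | x < X w]) = 0.
Proof.
move=> X0; near=> x.
have x0 : 0 < x by near: x; exact: nbhs_pinfty_gt.
have mX : measurable_fun setT X by exact: measurable_funP.
have mgt : measurable [set w | x < X w].
  rewrite [X in measurable X](_ : _ = X @^-1` `]x, +oo[%classic).
    by rewrite -[X in measurable X]setTI; apply: mX.
  by apply/seteqP; split => w /=; rewrite in_itv/= andbT.
suff : P.-negligible [set w | x < X w] by move=> /measure_negligible -> //.
apply: negligibleS X0 => w /= xw Xw; move: xw; rewrite Xw.
by rewrite ltNge (ltW x0).
Unshelve. all: by end_near. Qed.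

(** * Small-argument asymptotics of the exponents *)

Lemma InG_ge0 d (T : measurableType d) (R : realType) (P : probability T R)
    (alpha : R) (S : R -> {RV P >-> R}) (t : R) :
  InG_subordinator alpha S -> 0 <= t -> {ae P, forall w, 0 <= S t w}.
Proof.
move=> [[S0 _ _ _ _] Smono _] t0; near=> w.
have <- : S 0 w = 0 by near: w.
have h : forall s t : R, 0 <= s -> s <= t -> S s w <= S t w by near: w.
exact: h.
Unshelve. all: by end_near. Qed.

(* At a negative argument [powR] takes the junk value 1, so [psi ^ alpha -> 0]
   rules out negative values of [psi] near 0. *)
Lemma laplace_exponent_gt0 (R : realType) (psi : R -> R) (alpha beta C : R) :
  0 < alpha -> 0 < beta -> 0 < C ->
  psi eta `^ alpha / eta `^ beta @[eta --> 0^'+] --> C ->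
  (\forall eta \near 0^'+, 0 < psi eta) /\ psi eta @[eta --> 0^'+] --> 0.
Proof.
move=> a0 b0 C0 psiC.
have psia0 : psi eta `^ alpha @[eta --> 0^'+] --> 0.
  rewrite -[X in _ --> X](mulr0 C).
  apply: cvg_trans (cvgM psiC (powR_cvg0 b0)); apply: near_eq_cvg; near=> eta.
  have eta0 : 0 < eta by near: eta; exact: nbhs_right_gt.
  by rewrite /= divfK// gt_eqF// powR_gt0.
have pos : \forall eta \near 0^'+, 0 < psi eta.
  near=> eta.
  have eta0 : 0 < eta by near: eta; exact: nbhs_right_gt.
  have h1 : 0 < psi eta `^ alpha / eta `^ beta.
    by near: eta; apply: cvgr_gt psiC _ C0.
  have h2 : psi eta `^ alpha < 1.
    by near: eta; apply: cvgr_lt psia0 _ ltr01.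
  rewrite ltNge le_eqVlt; apply/negP => /orP[/eqP p0|p0].
    by move: h1; rewrite p0 powR0 ?gt_eqF// mul0r ltxx.
  by move: h2; rewrite lt0_powR1// ltxx.
split => //.
have psia0r : psi eta `^ alpha @[eta --> 0^'+] --> 0^'+.
  move=> A [e /= e0 eA].
  suff h : \forall eta \near 0^'+, A (psi eta `^ alpha) by exact: h.
  near=> eta; apply: eA => /=; last first.
    by rewrite powR_gt0//; near: eta.
  by near: eta; move/cvgrPdist_lt : psia0; apply.
(* [psi] is recovered from its power [alpha] by the power [1 / alpha], legitimate where
   [psi > 0]. *)
have ai0 : 0 < alpha^-1 by rewrite invr_gt0.
apply: cvg_trans (cvg_comp _ _ psia0r (powR_cvg0 ai0)); apply: near_eq_cvg; near=> eta.
have p0 : 0 < psi eta by near: eta.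
by rewrite /= -powRrM divff ?gt_eqF// powRr1// ltW.
Unshelve. all: by end_near. Qed.

(** [psi] tends to 0 through positive values, so the two-sided bound on the incomplete gamma
    function applies at [psi eta], with an exponential factor tending to 1. *)
Lemma InG_exponent_asymptotic (R : realType) (psi : R -> R) (alpha beta C : R) :
  0 < alpha -> 0 < beta -> 0 < C ->
  psi eta `^ alpha / eta `^ beta @[eta --> 0^'+] --> C ->
  alpha * lower_incomplete_gamma alpha (psi eta) / eta `^ beta @[eta --> 0^'+] --> C.
Proof.
move=> a0 b0 C0 psiC; have [pos psi0] := laplace_exponent_gt0 a0 b0 C0 psiC.
apply: (@squeeze_cvgr _ _ _ _
  (fun eta => expR (- psi eta) * (psi eta `^ alpha / eta `^ beta))
  (fun eta => psi eta `^ alpha / eta `^ beta)) => //.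
- near=> eta.
  have eta0 : 0 < eta by near: eta; exact: nbhs_right_gt.
  have p0 : 0 < psi eta by near: eta.
  have /andP[h1 h2] := alpha_lower_incomplete_gamma a0 p0.
  have eb : 0 <= (eta `^ beta)^-1 by rewrite invr_ge0 powR_ge0.
  by rewrite mulrA !ler_wpM2r.
- rewrite -[X in _ --> X]mul1r; apply: cvgM => //.
  have E : 1 = expR (- 0) :> R by rewrite oppr0 expR0.
  rewrite [X in _ --> X]E.
  by apply: continuous_cvg; [exact: continuous_expR|exact: cvgN].
Unshelve. all: by end_near. Qed.

(** Squeezing by [z exp (- z) <= 1 - exp (- z) <= z] at [z = t * G eta], which tends to 0. *)
Lemma onem_expR_asymptotic (R : realType) (G : R -> R) (t beta C : R) :
  0 <= t -> 0 < beta ->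
  (\forall eta \near 0^'+, 0 <= G eta) ->
  G eta / eta `^ beta @[eta --> 0^'+] --> C ->
  (1 - expR (- (t * G eta))) / eta `^ beta @[eta --> 0^'+] --> t * C.
Proof.
move=> t0 b0 G0 GC.
have Gz : G eta @[eta --> 0^'+] --> 0.
  rewrite -[X in _ --> X](mulr0 C).
  apply: cvg_trans (cvgM GC (powR_cvg0 b0)); apply: near_eq_cvg; near=> eta.
  have eta0 : 0 < eta by near: eta; exact: nbhs_right_gt.
  by rewrite /= divfK// gt_eqF// powR_gt0.
have tGC : t * (G eta / eta `^ beta) @[eta --> 0^'+] --> t * C.
  by apply: cvgM => //; exact: cvg_cst.
apply: (@squeeze_cvgr _ _ _ _
  (fun eta => expR (- (t * G eta)) * (t * (G eta / eta `^ beta)))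
  (fun eta => t * (G eta / eta `^ beta))) => //.
- near=> eta.
  have eta0 : 0 < eta by near: eta; exact: nbhs_right_gt.
  have g0 : 0 <= G eta by near: eta.
  have eb : 0 <= (eta `^ beta)^-1 by rewrite invr_ge0 powR_ge0.
  rewrite [X in _ <= _ <= X]mulrA [t * (_ / _)]mulrA mulrA !ler_wpM2r//.
    by have := expR_ge1Dx (- (t * G eta)); lra.
  have := expR_ge1Dx (t * G eta).
  have := expR_gt0 (- (t * G eta)); set z := expR (- _) => z0.
  have <- : z^-1 = expR (t * G eta) by rewrite /z expRN invrK.
  move=> h; have := ler_wpM2l (ltW z0) h; rewrite divff ?gt_eqF//; lra.
- rewrite -[X in _ --> X]mul1r; apply: cvgM => //.
  have E : 1 = expR (- (t * 0)) :> R by rewrite mulr0 oppr0 expR0.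
  rewrite [X in _ --> X]E.
  apply: continuous_cvg; first exact: continuous_expR.
  by apply: cvgN; apply: cvgM => //; exact: cvg_cst.
Unshelve. all: by end_near. Qed.

(** * The tail of the subordinated process *)

Unset Implicit Arguments.

Theorem theorem3p2 (d : measure_display) (T : measurableType d) (R : realType)
    (P : probability T R) (Y S Q : R -> {RV P >-> R}) (psi : R -> R)
    (alpha beta c : R) :
  levy_process Y -> laplace_exponent Y psi ->
  0 < alpha < 1 ->
  InG_subordinator alpha S ->
  independent_processes Y S ->
  subordinated Y S Q ->
  0 < beta < 1 ->
  asymp_equiv (0 : R)^'+ (fun eta => psi eta `^ alpha / eta)
    (fun eta => c `^ alpha * eta `^ (beta - 1)) ->
  forall t : R, 0 <= t ->
    asymp_equiv (pinfty_nbhs R) (fun x => fine (P [set w | x < Q t w]))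
      (fun x => c `^ alpha * t * x `^ (- beta) / Gamma (1 - beta)).
Proof.
move=> levyY lapY /andP[a0 a1] InG ind sub b01 equiv t t0.
have /andP[b0 b1] := b01.
have St0 := InG_ge0 InG t0.
have lapQ := fun eta => @laplace_subordinated _ _ _ P Y S Q psi t eta levyY lapY
  St0 ind (sub t t0) t0.
have scale (k : R) (A : R -> Prop) : 0 < k ->
    (\forall eta \near 0^'+, A eta) -> \forall eta \near 0^'+, A (k * eta).
  by move=> k0 hA; exact: (cvg_scale_at_right0 k0).
(* Both degenerate cases: [psi] vanishes near 0, or [t = 0]. *)
have degenerate : (\forall eta \near 0^'+, 0 <= psi eta /\
    (\int[P]_w (expR (- (psi eta * S t w)))%:E = 1)%E) -> c `^ alpha * t = 0 ->
    asymp_equiv (pinfty_nbhs R) (fun x => fine (P [set w | x < Q t w]))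
      (fun x => c `^ alpha * t * x `^ (- beta) / Gamma (1 - beta)).
  move=> h ct0; right.
  have Q0 : {ae P, forall w, Q t w = 0}.
    (* [laplace_eq1_ae0] uses the transform at [eta] and [2 * eta], and the latter needs the sign of
       [psi] at [4 * eta]. *)
    have h2 := scale 2 _ (ltr0n _ 2) h.
    have h4 := scale 2 _ (ltr0n _ 2) h2.
    near (0 : R)^'+ => eta.
    have eta0 : 0 < eta by near: eta; exact: nbhs_right_gt.
    have e2 : 0 < 2 * eta by rewrite mulr_gt0.
    have [p1 E1] : 0 <= psi eta /\ (\int[P]_w (expR (- (psi eta * S t w)))%:E = 1)%E.
      by near: eta; exact: h.
    have [p2 E2] : 0 <= psi (2 * eta) /\
        (\int[P]_w (expR (- (psi (2 * eta) * S t w)))%:E = 1)%E.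
      by near: eta; exact: h2.
    have [p4 _] : 0 <= psi (2 * (2 * eta)) /\
        (\int[P]_w (expR (- (psi (2 * (2 * eta)) * S t w)))%:E = 1)%E.
      by near: eta; exact: h4.
    apply: (laplace_eq1_ae0 eta0).
    - by have [_ ->] := lapQ eta eta0 p1 p2.
    - by have [_ ->] := lapQ (2 * eta) e2 p2 p4.
  apply: filterS (tail_ae0 Q0) => x ->.
  by rewrite ct0 !mul0r.
case: equiv => [ratio|vanish]; last first.
  apply: degenerate.
    near=> eta.
    have eta0 : 0 < eta by near: eta; exact: nbhs_right_gt.
    have [p0 _] : psi eta `^ alpha / eta = 0 /\ c `^ alpha * eta `^ (beta - 1) = 0.
      by near: eta; exact: vanish.
    have -> : psi eta = 0.
      by move/eqP: p0; rewrite mulf_eq0 invr_eq0 (gt_eqF eta0) orbF => /eqP/powR_eq0_eq0.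
    split => //; under eq_integral do rewrite mul0r oppr0 expR0.
    by rewrite integral_cst// mul1e; exact: probability_setT.
  near (0 : R)^'+ => eta.
  have eta0 : 0 < eta by near: eta; exact: nbhs_right_gt.
  have [_ /eqP] : psi eta `^ alpha / eta = 0 /\ c `^ alpha * eta `^ (beta - 1) = 0.
    by near: eta; exact: vanish.
  rewrite mulf_eq0 [X in _ || X]gt_eqF ?powR_gt0// orbF => /eqP ->.
  by rewrite mul0r.
have C0 : 0 < c `^ alpha.
  (* If [c^alpha] were 0, the convention [u / 0 = 0] would make the ratio identically 0, and it
     could not tend to 1. *)
  rewrite lt_def powR_ge0 andbT; apply/eqP => c0.
  have : (fun=> 0 : R) x @[x --> (0 : R)^'+] --> (1 : R).
    apply: cvg_trans ratio; apply: near_eq_cvg; apply: nearW => x.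
    by rewrite c0 mul0r invr0 mulr0.
  move=> h1; have h0 : (fun=> 0 : R) x @[x --> (0 : R)^'+] --> (0 : R) by exact: cvg_cst.
  have /esym/eqP : 0 = 1 :> R by apply: (cvg_unique _ h0 h1) => //; exact: norm_hausdorff.
  by rewrite oner_eq0.
set C := c `^ alpha in C0 *.
have psiC : psi eta `^ alpha / eta `^ beta @[eta --> 0^'+] --> C.
  rewrite -[X in _ --> X]mulr1.
  apply: cvg_trans (cvgM (cvg_cst C) ratio); apply: near_eq_cvg; near=> eta.
  have eta0 : 0 < eta by near: eta; exact: nbhs_right_gt.
  rewrite /= -/C powRB; last by rewrite (gt_eqF eta0) implybT.
  rewrite powRr1 ?(ltW eta0)//; field.
  by rewrite (gt_eqF C0) (gt_eqF eta0) gt_eqF ?powR_gt0.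
have [pos _] := laplace_exponent_gt0 a0 b0 C0 psiC.
have pos2 := scale 2 _ (ltr0n _ 2) pos.
pose G eta := alpha * lower_incomplete_gamma alpha (psi eta).
have lapS eta : 0 < psi eta ->
    (\int[P]_w (expR (- (psi eta * S t w)))%:E = (expR (- (t * G eta)))%:E)%E.
  by move=> p0; have := InG_laplace InG t0 p0; rewrite unlock.
have GC := InG_exponent_asymptotic a0 b0 C0 psiC.
have G0 : \forall eta \near 0^'+, 0 <= G eta.
  near=> eta; have p0 : 0 < psi eta by near: eta.
  have /andP[+ _] := alpha_lower_incomplete_gamma a0 p0.
  by apply: le_trans; rewrite mulr_ge0 ?expR_ge0 ?powR_ge0.
move: t0; rewrite le_eqVlt => /predU1P[tz|tpos].
  apply: degenerate; last by rewrite -tz mulr0.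
  near=> eta; have p0 : 0 < psi eta by near: eta.
  by rewrite lapS// -tz mul0r oppr0 expR0 ltW.
left.
have lim1 := onem_expR_asymptotic (ltW tpos) b0 G0 GC.
have XL : (1 - \int[P]_w expR (- (eta * Q t w)))%R / eta `^ beta @[eta --> 0^'+] --> t * C.
  apply: cvg_trans lim1; apply: near_eq_cvg; near=> eta.
  have eta0 : 0 < eta by near: eta; exact: nbhs_right_gt.
  have p0 : 0 < psi eta by near: eta.
  have p2 : 0 < psi (2 * eta) by near: eta.
  have [_ E] := lapQ eta eta0 (ltW p0) (ltW p2).
  by rewrite /Rintegral E lapS.
(* Any small argument provides the exponential moment of the negative part, since the transform
   there equals a finite exponential. *)
have [eta0 eta00 iQ] : exists2 eta0 : R, 0 < eta0 &
    P.-integrable setT (fun w => (expR (- (eta0 * Q t w)))%:E).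
  near (0 : R)^'+ => eta; exists eta; first by near: eta; exact: nbhs_right_gt.
  have eta0 : 0 < eta by near: eta; exact: nbhs_right_gt.
  have p0 : 0 < psi eta by near: eta.
  have p2 : 0 < psi (2 * eta) by near: eta.
  have [_ E] := lapQ eta eta0 (ltW p0) (ltW p2).
  have mQ : measurable_fun setT (Q t) by exact: measurable_funP.
  apply/integrableP; split.
    apply/measurable_EFinP.
    apply: measurableT_comp => //; apply: measurableT_comp => //.
    by apply: measurable_funM => //; exact: measurable_cst.
  under eq_integral do rewrite gee0_abs ?lee_fin ?expR_ge0//.
  by rewrite E lapS// ltry.
have tC0 : 0 < t * C by rewrite mulr_gt0.
have := laplace_tauberian b01 (ltW tC0) eta00 iQ XL => tailC.
have Gam0 := Gamma_onem_gt0 b0 b1.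
(* The limit is positive, so multiplying by its inverse turns the limit statement into a ratio
   tending to 1. *)
have tailC' : x `^ beta * fine (P [set w | x < Q t w]) * (Gamma (1 - beta) / (t * C))
    @[x --> +oo] --> t * C / Gamma (1 - beta) * (Gamma (1 - beta) / (t * C)).
  by apply: cvgM tailC _; exact: cvg_cst.
rewrite mulrA divfK ?gt_eqF// divff ?gt_eqF// in tailC'.
apply: cvg_trans tailC'; apply: near_eq_cvg; near=> x.
have x0 : 0 < x by near: x; exact: nbhs_pinfty_gt.
rewrite /= powRN -/C; field.
by rewrite (gt_eqF C0) (gt_eqF tpos) (gt_eqF Gam0) gt_eqF ?powR_gt0.
Unshelve. all: by end_near. Qed.
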